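(* There exists an absolute constant $c>0$ such that for every $1<p\leq 2$ the Walsh-Carleson maximal operator $$ \mathrm{W} f(x):=\sup_{n\in\mathbb{N}}|\mathrm{W}_n f(x)|,\qquad x\in\mathbb{T}, $$ where $\mathrm{W}_n f$ denotes the $n$-th partial Walsh-Fourier sum of $f\in L^1(\mathbb{T})$, satisfies the operator norm bound $$ \|\mathrm{W}\|_{L^p(\mathbb{T})\to L^{p,\infty}(\mathbb{T})}\leq \frac{c}{p-1}, $$ that is, $\|\mathrm{W}f\|_{L^{p,\infty}(\mathbb{T})}\leq \frac{c}{p-1}\|f\|_{L^p(\mathbb{T})}$ for all $f\in L^p(\mathbb{T})$ and all $1<p\leq 2$.
   Context: $\mathbb{T}$ is identified with $[0,1)$ with Lebesgue measure. For $n\in\mathbb{N}=\{0,1,2,\dots\}$ with binary expansion $n=\sum_{j\geq 0}n_j2^j$, $n_j\in\{0,1\}$, the $n$-th Walsh character is $W_n(x)=\prod_{j\geq0}\big(r_j(x)\big)^{n_j}$, $x\in[0,1)$, where $r_j(x)=(-1)^{\lfloor 2^{j+1}x\rfloor}$ is the $j$-th Rademacher function. The $n$-th partial Walsh-Fourier sum of $f\in L^1(\mathbb{T})$ is $\mathrm{W}_nf(x)=\sum_{k=0}^{n-1}\Big(\int_{\mathbb{T}}f(y)W_k(y)\,dy\Big)W_k(x)$ (for $n=0$ the sum is empty). The weak-$L^p$ quasinorm is $\|h\|_{L^{p,\infty}(\mathbb{T})}=\sup_{\lambda>0}\lambda\,|\{x\in\mathbb{T}:|h(x)|>\lambda\}|^{1/p}$.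 *)

(* Defs.v *)
From mathcomp Require Import all_boot all_order all_algebra.
From mathcomp Require Import all_classical all_reals all_analysis.
From mathcomp Require Import complex.

Set Implicit Arguments.
Unset Strict Implicit.
Unset Printing Implicit Defensive.

Import Order.TTheory GRing.Theory Num.Theory.
Import numFieldNormedType.Exports.

Local Open Scope classical_set_scope.
Local Open Scope ring_scope.

(* A complex-valued function on the torus T = [0, 1) is represented by a
   function R -> R[i] of which only the values on [0, 1) are used. *)
Definition torus (R : realType) : set R := `[0, 1[.

Definition rademacher (R : realType) (j : nat) (x : R) : R :=
  (-1) ^ Num.floor (2 ^+ j.+1 * x).

Definition binary_digit (n j : nat) : nat := (n %/ 2 ^ j) %% 2.

(* The digits of n of index j >= n vanish since n < 2 ^ n, so that the product
   over all j >= 0 reduces to the product over j < n. *)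
Definition walsh (R : realType) (n : nat) (x : R) : R :=
  \prod_(j < n) rademacher j x ^+ binary_digit n j.

Definition walsh_coef (R : realType) (f : R -> R[i]) (k : nat) : R[i] :=
  Complex
    (\int[@lebesgue_measure R]_(y in @torus R) (complex.Re (f y) * walsh k y))
    (\int[@lebesgue_measure R]_(y in @torus R) (complex.Im (f y) * walsh k y)).

Definition walsh_partial_sum (R : realType) (n : nat) (f : R -> R[i]) (x : R) :
    R[i] :=
  \sum_(k < n) walsh_coef f k * (walsh k x)%:C%C.

(* [Normc.normc z : R] is the modulus of [z : R[i]]; [`|z|] has type [R[i]]. *)
Definition walsh_carleson (R : realType) (f : R -> R[i]) (x : R) : \bar R :=
  ereal_sup (range (fun n : nat => (Normc.normc (walsh_partial_sum n f x))%:E)).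

Definition Lp_norm (R : realType) (p : R) (f : R -> R[i]) : \bar R :=
  ('N[@lebesgue_measure R]_(p%:E)
     [(fun x => (Normc.normc (f x))%:E) \_ (@torus R)])%E.

Definition in_Lp (R : realType) (p : R) (f : R -> R[i]) : Prop :=
  [/\ measurable_fun (@torus R) (fun x => complex.Re (f x)),
      measurable_fun (@torus R) (fun x => complex.Im (f x)) &
      (Lp_norm p f < +oo)%E].

Definition weak_Lp_norm (R : realType) (p : R) (h : R -> \bar R) : \bar R :=
  ereal_sup [set (l%:E * (@lebesgue_measure R
      [set x | torus x /\ (l%:E < `|h x|)%E]) `^ p^-1)%E | l in [set l : R | 0 < l]].

(* Main.v *)
(** Only finitely many binary digits matter for [W_n] with [n < 2 ^ M], so the maximal
    operator is studied on [{0,1}^M], with a bound independent of [M], and then transferred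
    to [0, 1) through averages over dyadic intervals of length [2 ^ - M].

    Let [|f| ^ p] have dyadic maximal function at most 1 outside a set of size at most
    [A = |f|_p ^ p], and let [E] be the part of the complement where the maximal operator
    exceeds [K].  Linearizing, the integral over [E] of [|W_(N x) f x|] is a sum over
    bitiles, which is decomposed greedily into trees: a tree of size at most [s] and mass at
    most [m] contributes [O(s m |I_T|)].  Trees of mass about [m] have total length at most
    [|E| / m].  For trees of size about [s], orthogonality only gives an [L^2] bound, while
    [f] is merely in [L^p]; but on each Calderon-Zygmund stopping interval only as many
    frequencies occur as there are trees over it, say [n], and an exponential sum [G] with
    [n] frequencies satisfies [sup |G| ^ 2 <= n mean(|G| ^ 2)].  This multi-frequency
    argument bounds the total length by [(24 / s ^ 2) ^ (1 / (p - 1)) A].  Taking the mass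
    [2 ^ - j] and the size proportional to [r ^ j] with [r = 2 ^ (- (p - 1) / 2)], step [j]
    contributes [O(r ^ j (|E| + A))].  The geometric series [1 / (1 - r) = O(1 / (p - 1))]
    yields [K |E| <= C (|E| + A) / (p - 1)], hence [|E| <= A] for [K = C' / (p - 1)], and the
    weak-type bound follows by scaling. *)

Require Import Defs.
From mathcomp Require Import all_boot all_order all_algebra.
From mathcomp Require Import ring lra zify.
From mathcomp Require Import reals sequences exp.

Set Implicit Arguments.
Unset Strict Implicit.
Unset Printing Implicit Defensive.

Import Order.TTheory GRing.Theory Num.Theory.

Local Open Scope ring_scope.

(** * Dyadic intervals and averages at resolution [2 ^ - M] *)

Section DyadicModel.
Variables (R : realType) (M : nat).
Notation X := {ffun 'I_M -> bool}.
Implicit Types (x y z m n xi : X) (k l : nat) (i j : 'I_M) (f g a : X -> R).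

(* Points of [0, 1) at resolution 2 ^ - M and frequencies below 2 ^ M are both encoded by
   their binary digits: a point with the most significant digit first, a frequency with
   the digit of weight 2 ^ i at index i.  Thus [lo k] says that two points lie in the same
   dyadic interval of length 2 ^ - k, and [hi k] that two frequencies lie in the same
   dyadic interval of length 2 ^ k. *)
Definition lo k x y := [forall i : 'I_M, (i < k)%N ==> (x i == y i)].
Definition hi k x y := [forall i : 'I_M, (k <= i)%N ==> (x i == y i)].

Lemma loP k x y : reflect (forall i : 'I_M, (i < k)%N -> x i = y i) (lo k x y).
Proof.
by apply: (iffP forallP) => [h i ik|h i]; [have /implyP/(_ ik)/eqP := h i|
  apply/implyP => /h ->].
Qed.

Lemma hiP k x y : reflect (forall i : 'I_M, (k <= i)%N -> x i = y i) (hi k x y).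
Proof.
by apply: (iffP forallP) => [h i ik|h i]; [have /implyP/(_ ik)/eqP := h i|
  apply/implyP => /h ->].
Qed.

Lemma lo_refl k : reflexive (lo k).
Proof. by move=> x; apply/loP. Qed.

Lemma lo_sym k : symmetric (lo k).
Proof. by move=> x y; apply/loP/loP => h i ik; rewrite h. Qed.

Lemma lo_trans k : transitive (lo k).
Proof. by move=> y x z /loP xy /loP yz; apply/loP => i ik; rewrite xy ?yz. Qed.

Lemma lo_le k l x y : (k <= l)%N -> lo l x y -> lo k x y.
Proof. by move=> kl /loP h; apply/loP => i ik; apply: h; exact: leq_trans kl. Qed.

Lemma lo_eql k x y z : lo k x y -> lo k x z = lo k y z.
Proof.
move=> xy; apply/idP/idP => [xz|]; last exact: lo_trans.
by apply: lo_trans xz; rewrite lo_sym.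
Qed.

Lemma lo_full k x y : (M <= k)%N -> lo k x y = (x == y).
Proof.
move=> Mk; apply/loP/eqP => [h|-> //]; apply/ffunP => i; apply: h.
exact: leq_trans Mk.
Qed.

Lemma hi_refl k : reflexive (hi k).
Proof. by move=> x; apply/hiP. Qed.

Lemma hi_sym k : symmetric (hi k).
Proof. by move=> x y; apply/hiP/hiP => h i ik; rewrite h. Qed.

Lemma hi_trans k : transitive (hi k).
Proof. by move=> y x z /hiP xy /hiP yz; apply/hiP => i ik; rewrite xy ?yz. Qed.

Lemma hi_le k l x y : (k <= l)%N -> hi k x y -> hi l x y.
Proof. by move=> kl /hiP h; apply/hiP => i ik; apply: h; exact: leq_trans ik. Qed.

Lemma hi_eql k x y z : hi k x y -> hi k x z = hi k y z.
Proof.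
move=> xy; apply/idP/idP => [xz|]; last exact: hi_trans.
by apply: hi_trans xz; rewrite hi_sym.
Qed.

Lemma hiS (k : 'I_M) x y : hi k x y = (x k == y k) && hi k.+1 x y.
Proof.
apply/hiP/andP => [h|[/eqP xyk /hiP h] i].
  by split; [rewrite h|apply/hiP => i ki; apply: h; exact: ltnW].
by rewrite leq_eqVlt => /orP[/eqP/val_inj <-//|/h].
Qed.

Definition flip i x : X := [ffun j => x j (+) (j == i)].

Lemma flipE i x j : flip i x j = x j (+) (j == i).
Proof. by rewrite ffunE. Qed.

Lemma flip_id i x : flip i x i = ~~ x i.
Proof. by rewrite flipE eqxx addbT. Qed.

Lemma flip_neq i x j : j != i -> flip i x j = x j.
Proof. by move=> /negbTE ji; rewrite flipE ji addbF. Qed.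

Lemma flipK i : involutive (flip i).
Proof. by move=> x; apply/ffunP => j; rewrite !flipE -addbA addbb addbF. Qed.

Lemma flip_inj i : injective (flip i).
Proof. exact: inv_inj (flipK i). Qed.

Lemma lo_flip k i x : (k <= i)%N -> lo k x (flip i x).
Proof.
move=> ki; apply/loP => j jk; rewrite flip_neq//.
by apply: contraTneq jk => ->; rewrite -leqNgt.
Qed.

(** Flipping a digit permutes the points. The orthogonality relations below, between martingale
    differences, packets or characters, all come down to such a flip. *)
Lemma sum_flip_eq0 i f : (forall x, f (flip i x) = - f x) -> \sum_x f x = 0.
Proof.
move=> fN; have : \sum_x f x = - \sum_x f x.
  rewrite [LHS](reindex_inj (@flip_inj i)) -sumrN.
  by apply: eq_bigr => x _; rewrite fN.
by move=> ?; lra.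
Qed.

(* The number of points in a dyadic interval of length 2 ^ - k. *)
Definition vol k : R := 2 ^+ (M - k).

Lemma vol_gt0 k : 0 < vol k.
Proof. by rewrite exprn_gt0. Qed.

Lemma vol_neq0 k : vol k != 0.
Proof. by rewrite lt0r_neq0// vol_gt0. Qed.

Lemma vol_ge0 k : 0 <= vol k.
Proof. exact: ltW (vol_gt0 k). Qed.

Lemma volV_ge0 k : 0 <= (vol k)^-1.
Proof. by rewrite invr_ge0 vol_ge0. Qed.

Lemma volS k : (k < M)%N -> vol k = 2 * vol k.+1.
Proof. by move=> kM; rewrite /vol -exprS; congr (_ ^+ _); lia. Qed.

Lemma vol_full k : (M <= k)%N -> vol k = 1.
Proof. by rewrite -subn_eq0 /vol => /eqP ->. Qed.

Lemma sum_lo k x : \sum_(y | lo k x y) (1 : R) = vol k.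
Proof.
have [Mk|] := leqP M k.
  rewrite (eq_bigl (pred1 x)) ?big_pred1_eq ?vol_full// => y.
  by rewrite lo_full// eq_sym.
move=> kM; rewrite -(subKn (ltnW kM)); move: (M - k)%N (leq_subr k M) => d.
elim: d x => [|d IH] x dM.
  rewrite (eq_bigl (pred1 x)) ?big_pred1_eq ?vol_full ?subn0// => y.
  by rewrite lo_full ?subn0// eq_sym.
have lM : (M - d.+1 < M)%N by lia.
pose i := Ordinal lM.
have E : (M - d = (M - d.+1).+1)%N by lia.
rewrite volS// -E (bigID (fun y => y i == x i)) /=.
have -> : \sum_(y | lo (M - d.+1) x y && (y i != x i)) (1 : R) =
          \sum_(y | lo (M - d) (flip i x) y) 1.
  apply: eq_bigl => y; rewrite E; apply/andP/loP => [[/loP h xi] j jd|h].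
    have [->|/eqP ji] := eqVneq j i.
      by rewrite flip_id; case: (y i) (x i) xi => [] [].
    rewrite flip_neq//; last exact/eqP.
    apply: h; rewrite ltn_neqAle -ltnS jd andbT.
    by apply/eqP => ji'; apply: ji; exact: val_inj.
  split; last by rewrite -h// flip_id; case: (x i).
  apply/loP => j jd; rewrite -h ?flip_neq//; last exact: ltnW.
  by apply: contraTneq jd => ->; rewrite ltnn.
rewrite (IH _ (ltnW dM)).
have -> : \sum_(y | lo (M - d.+1) x y && (y i == x i)) (1 : R) =
          \sum_(y | lo (M - d) x y) 1.
  apply: eq_bigl => y; rewrite E; apply/andP/loP => [[/loP h /eqP xi] j jd|h].
    have [->|/eqP ji] := eqVneq j i; first by rewrite xi.
    apply: h; rewrite ltn_neqAle -ltnS jd andbT.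
    by apply/eqP => ji'; apply: ji; exact: val_inj.
  split; last by rewrite h.
  by apply/loP => j jd; rewrite h//; exact: ltnW.
by rewrite IH ?(ltnW dM)//; lra.
Qed.

Definition avg k g x : R := (vol k)^-1 * \sum_(y | lo k x y) g y.

Lemma avg_ext k f g x : (forall y, lo k x y -> f y = g y) -> avg k f x = avg k g x.
Proof. by move=> fg; congr (_ * _); apply: eq_bigr => y /fg. Qed.

Lemma avg_lo k g x y : lo k x y -> avg k g x = avg k g y.
Proof. by move=> xy; congr (_ * _); apply: eq_bigl => z; exact: lo_eql. Qed.

Lemma avg_cst k c g x : (forall y, lo k x y -> g y = c) -> avg k g x = c.
Proof.
move=> gc; rewrite /avg (eq_bigr (fun=> c * 1)) => [|y /gc ->]; last by rewrite mulr1.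
by rewrite -mulr_sumr sum_lo mulrCA mulVf ?mulr1 ?vol_neq0.
Qed.

Lemma avgZ k c g x : avg k (fun y => c * g y) x = c * avg k g x.
Proof. by rewrite /avg -mulr_sumr mulrCA. Qed.

Lemma avgD k f g x : avg k (fun y => f y + g y) x = avg k f x + avg k g x.
Proof. by rewrite /avg big_split mulrDr. Qed.

Lemma avg_sum k (I : Type) (s : seq I) (P : pred I) (F : I -> X -> R) x :
  avg k (fun y => \sum_(i <- s | P i) F i y) x = \sum_(i <- s | P i) avg k (F i) x.
Proof. by rewrite /avg exchange_big /= mulr_sumr. Qed.

Lemma ler_avg k f g x : (forall y, lo k x y -> f y <= g y) -> avg k f x <= avg k g x.
Proof.
by move=> fg; rewrite ler_wpM2l ?volV_ge0//; exact: ler_sum.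
Qed.

Lemma avg_ge0 k f x : (forall y, 0 <= f y) -> 0 <= avg k f x.
Proof.
by move=> f0; rewrite mulr_ge0 ?volV_ge0//; exact: sumr_ge0.
Qed.

Lemma avg_full k g x : (M <= k)%N -> avg k g x = g x.
Proof. by move=> Mk; apply: avg_cst => y; rewrite lo_full// => /eqP ->. Qed.

Lemma avgS_le k g x : (forall y, 0 <= g y) -> avg k.+1 g x <= 2 * avg k g x.
Proof.
move=> g0; have [kM|Mk] := ltnP k M; last first.
  rewrite !avg_full//; last exact: leqW.
  by have := g0 x; lra.
have -> : 2 * avg k g x = (vol k.+1)^-1 * \sum_(y | lo k x y) g y.
  by rewrite /avg (volS kM); field; rewrite vol_neq0.
rewrite /avg ler_wpM2l ?volV_ge0// [leRHS](bigID (fun y => lo k.+1 x y)) /=.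
rewrite [X in _ <= X + _](eq_bigl (fun y => lo k.+1 x y)) => [|y].
  by rewrite lerDl sumr_ge0.
by rewrite andb_idl// => /lo_le; apply.
Qed.

(** The value at [x] is fixed by that many digits of [x], so the intervals of length [2 ^ - t x]
    around the points [x] form a partition. *)
Definition stopping (t : X -> nat) := forall x y, lo (t x) x y -> t x = t y.

(* The conditional expectation at a stopping time preserves integrals against
   functions which are constant on the stopping intervals. *)
Lemma sum_avg_stopping t a g : stopping t ->
  (forall x y, lo (t x) x y -> a x = a y) ->
  \sum_x a x * avg (t x) g x = \sum_x a x * g x.
Proof.
move=> st sa; rewrite /avg.
under eq_bigr do rewrite mulrA mulr_sumr big_mkcond.
rewrite exchange_big /=; apply: eq_bigr => y _.
rewrite (eq_bigr (fun x => if lo (t y) y x then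
   (a y / vol (t y) * g y) * 1 else 0)) => [|x _].
  rewrite -big_mkcond -mulr_sumr sum_lo.
  by field; rewrite vol_neq0.
have [xy|/negP xy] := ifP.
  by rewrite -(st _ _ xy) lo_sym xy (sa _ _ xy) mulr1.
by case: ifP => // yx; case: xy; rewrite -(st _ _ yx) lo_sym.
Qed.

Lemma sum_avg k a g : (forall x y, lo k x y -> a x = a y) ->
  \sum_x a x * avg k g x = \sum_x a x * g x.
Proof. by move=> ak; apply: (@sum_avg_stopping (fun=> k)). Qed.

(** * Walsh characters *)

Definition chr n x : R := \prod_i (-1) ^+ (n i && x i).
Definition rad i x : R := (-1) ^+ x i.

Lemma rad_sqr i x : rad i x * rad i x = 1.
Proof. by rewrite /rad -expr2 sqrr_sign. Qed.

Lemma chr_sqr n x : chr n x * chr n x = 1.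
Proof. by rewrite -big_split big1//= => i _; rewrite -expr2 sqrr_sign. Qed.

Lemma normr_chr n x : `|chr n x| = 1.
Proof. by rewrite normr_prod big1// => i _; rewrite normrX normrN1 expr1n. Qed.

Lemma normr_rad i x : `|rad i x| = 1.
Proof. by rewrite normrX normrN1 expr1n. Qed.

Lemma rad_flip i x : rad i (flip i x) = - rad i x.
Proof. by rewrite /rad flip_id; case: (x i); rewrite ?expr0 ?expr1 ?opprK. Qed.

Lemma rad_flip_neq i j x : i != j -> rad i (flip j x) = rad i x.
Proof. by move=> ij; rewrite /rad flip_neq. Qed.

Lemma chr_flip n i x : chr n (flip i x) = (-1) ^+ n i * chr n x.
Proof.
rewrite /chr (bigD1 i)//= [in RHS](bigD1 i)//= flip_id mulrA; congr (_ * _).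
  by case: (n i); case: (x i); rewrite /= ?expr0 ?expr1 ?mulr1 ?mulrNN ?mulr1.
by apply: eq_bigr => j ji; rewrite flip_neq.
Qed.

(** Digits below [k] contribute squares of signs, and from [k] on the frequencies agree. Hence
    characters sharing a frequency interval are proportional on the dual time interval. *)
Lemma chr_pair n xi k x y : hi k n xi -> lo k x y ->
  chr n x * chr n y = chr xi x * chr xi y.
Proof.
move=> /hiP nxi /loP xy; rewrite -!big_split; apply: eq_bigr => i _ /=.
have [ik|ki] := ltnP i k; last by rewrite nxi.
by rewrite xy// -!expr2 !sqrr_sign.
Qed.

(** * Wave packet coefficients *)

(* For [n k] true, up to sign, the mean of [f] against the wave packet of the lower half of
   the bitile named by [(k, x, n)]. *)
Definition coef f (k : 'I_M) n x : R := avg k (fun y => f y * chr n y * rad k y) x.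

Lemma coef_lo f (k : 'I_M) n x y : lo k x y -> coef f k n x = coef f k n y.
Proof. exact: avg_lo. Qed.

Lemma coef_hi f (k : 'I_M) n xi x : hi k n xi ->
  chr n x * coef f k n x = chr xi x * coef f k xi x.
Proof.
move=> nxi; rewrite /coef -!avgZ; apply: avg_ext => y xy.
have := chr_pair nxi xy => E.
transitivity (chr n x * chr n y * f y * rad k y); first by ring.
by rewrite E; ring.
Qed.

(* [(k, x, n)] stands for the bitile whose time interval has length 2 ^ - k and contains
   [x], and whose frequency interval has length 2 ^ k.+1 and contains [n].  A bitile has
   several such names; sets of bitiles are therefore required to be [saturated] below. *)
Definition tile := ('I_M * X * X)%type.

End DyadicModel.

Section Martingales.
Variables (R : realType) (M : nat).
Notation X := {ffun 'I_M -> bool}.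
Notation tile := (tile M).
Implicit Types (x y z m n xi : X) (k l : nat) (i j : 'I_M) (f g a : X -> R).
Lemma sqr_sum_le (I : finType) (B : pred I) (a : I -> R) :
  (\sum_(i | B i) a i) ^+ 2 <= (\sum_(i | B i) 1) * \sum_(i | B i) a i ^+ 2.
Proof.
set c := \sum_(i | B i) 1; set s := \sum_(i | B i) a i.
have c0 : 0 <= c by apply: sumr_ge0.
have : 0 <= \sum_(i | B i) (c * a i - s) ^+ 2 by apply: sumr_ge0 => i _; exact: sqr_ge0.
have -> : \sum_(i | B i) (c * a i - s) ^+ 2 =
          c * (c * \sum_(i | B i) a i ^+ 2 - s ^+ 2).
  transitivity (\sum_(i | B i) (c ^+ 2 * a i ^+ 2 + (- (2 * c * s) * a i + s ^+ 2 * 1))).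
    by apply: eq_bigr => i _; ring.
  by rewrite !big_split /= -!mulr_sumr -/c -/s; ring.
have [c00|cN0] := eqVneq c 0.
  rewrite c00 !mul0r => _; suff -> : s = 0 by rewrite expr0n.
  have cE : c = #|B|%:R by rewrite /c sumr_const.
  rewrite /s big_pred0// => i; apply/negP => Bi.
  by move/eqP: c00; rewrite cE pnatr_eq0 => /eqP/card0_eq/(_ i); rewrite unfold_in /= Bi.
by rewrite pmulr_rge0 ?lt0r ?cN0// subr_ge0.
Qed.

(** * Stopping times *)

(** The value is [M] when no level below [M] satisfies [p]; at level [M] intervals are single
    points. *)
Definition first (p : nat -> X -> bool) x := find (fun k => p k x) (iota 0 M).

Lemma first_le p x : (first p x <= M)%N.
Proof. by rewrite -[leqRHS](size_iota 0) find_size. Qed.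

Lemma first_true p x : (first p x < M)%N -> p (first p x) x.
Proof.
move=> fM; have : has (fun k => p k x) (iota 0 M) by rewrite has_find size_iota.
by move=> /(nth_find 0%N); rewrite nth_iota.
Qed.

Lemma first_false p x k : (k < first p x)%N -> ~~ p k x.
Proof.
move=> kf; have := before_find 0%N kf; rewrite nth_iota ?add0n ?(leq_trans kf)//.
  by move->.
exact: first_le.
Qed.

Lemma first_stopping p : (forall k x y, lo k x y -> p k x = p k y) ->
  stopping (first p).
Proof.
move=> plo x y xy; case: (ltngtP (first p x) (first p y)) => // lt.
  have := first_true (leq_trans lt (first_le p y)).
  by rewrite (plo _ _ _ xy) => pf; have := first_false lt; rewrite pf.
have := first_true (leq_trans lt (first_le p x)).
rewrite -(plo _ x y); last exact: lo_le (ltnW lt) xy.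
by move=> pf; have := first_false lt; rewrite pf.
Qed.

(** * Doob's maximal inequality *)

Section Doob.
Variable D : 'I_M -> X -> R.
Hypothesis Dlo : forall (k : 'I_M) x y, lo k.+1 x y -> D k x = D k y.
Hypothesis Dflip : forall (k : 'I_M) x, D k (flip k x) = - D k x.

(** [Dlo] and [Dflip] make [D] a sequence of martingale differences: [D k] depends on the first
    [k.+1] digits and has conditional mean zero given the first [k]. *)
Definition partial k x : R := \sum_(i < M | (i < k)%N) D i x.

Fixpoint running k x : R :=
  if k is k'.+1 then Num.max (running k' x) `|partial k x| else 0.

Definition maximal x : R := running M x.

Lemma partialS (k : 'I_M) x : partial k.+1 x = partial k x + D k x.
Proof.
rewrite /partial (bigD1 k) ?ltnS//= addrC; congr (_ + _).
by apply: eq_bigl => i; rewrite ltnS [in RHS]ltn_neqAle andbC.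
Qed.

Lemma partial0 x : partial 0 x = 0.
Proof. by rewrite /partial big_pred0. Qed.

Lemma partial_flip (k : 'I_M) x : partial k (flip k x) = partial k x.
Proof. by apply: eq_bigr => i ik; rewrite (@Dlo i _ x)// lo_sym lo_flip. Qed.

Lemma running_ge0 k x : 0 <= running k x.
Proof. by elim: k => //= k IH; rewrite le_max IH. Qed.

Lemma maximal_ge0 x : 0 <= maximal x.
Proof. exact: running_ge0. Qed.

Lemma le_running l k x : (l <= k)%N -> `|partial l x| <= running k x.
Proof.
elim: k => [|k IH]; first by rewrite leqn0 => /eqP ->; rewrite partial0 normr0.
by rewrite leq_eqVlt le_max => /orP[/eqP ->|/IH ->//]; rewrite lexx orbT.
Qed.

Lemma le_maximal k x : (k <= M)%N -> `|partial k x| <= maximal x.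
Proof. exact: le_running. Qed.

Lemma eq_running k x y : (forall l, (l <= k)%N -> partial l x = partial l y) ->
  running k x = running k y.
Proof.
elim: k => //= k IH h; rewrite h// IH// => l lk.
by apply: h; exact: leqW.
Qed.

Lemma running_flip l (k : 'I_M) x : (l <= k)%N ->
  running l (flip k x) = running l x.
Proof.
move=> lk; apply: eq_running => m mk; apply: eq_bigr => i im.
by rewrite (@Dlo i _ x)// lo_sym lo_flip// (leq_trans im)// (leq_trans mk).
Qed.

(* Pathwise form of Doob's inequality: the quantity [2 m^2 - 4 m |s|], with [m] the
   running maximum of [|s|], decreases up to a martingale increment. *)
Lemma doob : \sum_x maximal x ^+ 2 <= 4 * \sum_x partial M x ^+ 2.
Proof.
pose Q k x := 2 * running k x ^+ 2 - 4 * running k x * `|partial k x|.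
have QS (k : 'I_M) : \sum_x Q k.+1 x <= \sum_x Q k x.
  pose g x := 4 * running k x * (Num.sg (partial k x) * D k x).
  have g0 : \sum_x g x = 0.
    apply: (@sum_flip_eq0 _ _ k) => x.
    by rewrite /g running_flip// partial_flip Dflip; ring.
  suff H x : Q k.+1 x <= Q k x - g x.
    apply: (@le_trans _ _ (\sum_x (Q k x - g x))); first by apply: ler_sum => x _.
    by rewrite big_split /= sumrN g0 subr0.
  have m0 : 0 <= running k x := le_trans (normr_ge0 _) (le_running x (leqnn k)).
  have Hs : `|partial k x| + Num.sg (partial k x) * D k x <= `|partial k.+1 x|.
    rewrite partialS; set s := partial k x; set d := D k x.
    have -> : `|s| + Num.sg s * d = Num.sg s * (s + d) by rewrite normrEsg mulrDr.
    rewrite (le_trans (ler_norm _))// normrM normr_sg.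
    by case: (s == 0); rewrite ?mul0r ?mul1r.
  rewrite /Q /g /=.
  move: m0 Hs (le_running x (leqnn k)).
  move: (running k x) (`|partial k.+1 x|) (`|partial k x|) => m u v.
  move: (Num.sg _ * _) => d m0 Hs vm.
  (* At a new maximum the left side is [- 2 * u ^+ 2], and the two sides differ by twice the square
     of [m - u]. *)
  have : 2 * Num.max m u ^+ 2 - 4 * Num.max m u * u <= 2 * m ^+ 2 - 4 * m * u.
    case: (leP m u) => mu; last exact: lexx.
    have := sqr_ge0 (m - u); lra.
  have : m * (v + d) <= m * u by rewrite ler_wpM2l.
  lra.
have Q0 k : (k <= M)%N -> \sum_x Q k x <= 0.
  elim: k => [|k IH] kM; last exact: le_trans (QS (Ordinal kM)) (IH (ltnW kM)).
  apply: sumr_le0 => x _; rewrite /Q /= partial0 normr0; lra.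
have : \sum_x maximal x ^+ 2 <= \sum_x (4 * partial M x ^+ 2 + Q M x).
  apply: ler_sum => x _; rewrite /Q -[maximal x]/(running M x).
    rewrite -(real_normK (num_real (partial M x))).
  have := sqr_ge0 (running M x - 2 * `|partial M x|); lra.
rewrite big_split /= -mulr_sumr => H; apply: le_trans H _.
by rewrite gerDl; exact: Q0.
Qed.

Lemma sum_partial_sqr : \sum_x partial M x ^+ 2 = \sum_x \sum_k D k x ^+ 2.
Proof.
suff H k : (k <= M)%N ->
    \sum_x partial k x ^+ 2 = \sum_x \sum_(i < M | (i < k)%N) D i x ^+ 2.
  by rewrite H//; apply: eq_bigr => x _; apply: eq_bigl => i; rewrite ltn_ord.
elim: k => [|k IH] kM.
  by apply: eq_bigr => x _; rewrite partial0 big_pred0// expr0n.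
pose k' := Ordinal kM.
transitivity (\sum_x (partial k x ^+ 2 + (2 * partial k x * D k' x + D k' x ^+ 2))).
  by apply: eq_bigr => x _; rewrite (@partialS k'); ring.
rewrite big_split /= big_split /= (@sum_flip_eq0 _ _ k' (fun x => 2 * partial k x * D k' x)).
  rewrite add0r (IH (ltnW kM)) -big_split /=; apply: eq_bigr => x _.
  rewrite [RHS](bigD1 k') ?ltnS//= addrC; congr (_ + _).
  by apply: eq_bigl => i; rewrite ltnS [LHS]ltn_neqAle andbC.
by move=> x; rewrite (@partial_flip k') Dflip; ring.
Qed.

End Doob.
End Martingales.

Section Forms.
Variables (R : realType) (M : nat).
Notation X := {ffun 'I_M -> bool}.
Notation chr := (@chr R M).
Notation rad := (@rad R M).
Notation vol := (@vol R M).
Notation tile := (tile M).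
Implicit Types (x y z m n xi : X) (k l : nat) (i j : 'I_M) (f g a : X -> R).
Implicit Types (P Q : {set tile}) (T U : tile).
(** * The model form on a set of tiles *)

Definition scale T : 'I_M := T.1.1.
Definition loc T : X := T.1.2.
Definition freq T : X := T.2.
Definition inside T x := lo (scale T) (loc T) x.

(* [below T U]: the time interval of [U] is contained in that of [T] and the frequency
   of [T] lies in the frequency interval of [U]. *)
Definition below T U :=
  [&& (scale T <= scale U)%N, inside T (loc U) & hi (scale U).+1 (freq T) (freq U)].

Definition saturated P := forall (k : 'I_M) x y m n,
  lo k x y -> hi k.+1 m n -> ((k, x, m) \in P) = ((k, y, n) \in P).

Lemma saturatedI P Q : saturated P -> saturated Q -> saturated (P :&: Q).
Proof. by move=> sP sQ k x y m n xy mn; rewrite !inE (sP _ _ _ _ _ xy mn) (sQ _ _ _ _ _ xy mn). Qed.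

Lemma saturatedD P Q : saturated P -> saturated Q -> saturated (P :\: Q).
Proof. by move=> sP sQ k x y m n xy mn; rewrite !inE (sP _ _ _ _ _ xy mn) (sQ _ _ _ _ _ xy mn). Qed.

Lemma saturated_below T : saturated [set U | below T U].
Proof.
move=> k x y m n xy mn; rewrite !inE /below /inside /=.
case: leqP => //= Tk; congr (_ && _).
  by rewrite lo_sym (lo_eql _ (lo_le Tk xy)) lo_sym.
by rewrite hi_sym (hi_eql _ mn) hi_sym.
Qed.

Variable f : X -> R.

(* The trees entering the size are those whose top frequency lies in the upper halves of
   the tiles: the wave packets of the lower halves are then modulated Haar functions. *)
Definition size_le P (s : R) := forall T,
  \sum_(x | inside T x) \sum_(k < M |
     [&& (scale T <= k)%N, freq T k & (k, x, freq T) \in P])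
    coef f k (freq T) x ^+ 2 <= s ^+ 2 * vol (scale T).

Lemma size_leS P Q s : P \subset Q -> size_le Q s -> size_le P s.
Proof.
move=> PQ sQ T; apply: le_trans (sQ T); apply: ler_sum => x _.
rewrite [leLHS]big_mkcond [leRHS]big_mkcond; apply: ler_sum => k _ /=.
case: ifP => [/and3P[-> -> /(subsetP PQ) ->]//|_].
by case: ifP => // _; exact: sqr_ge0.
Qed.

(** [size_le] is tested on the top [(k, x, n)], keeping only the term of scale [k], which is
    constant over the time interval. *)
Lemma coef_le_size P s (k : 'I_M) x n : saturated P -> size_le P s -> 0 <= s ->
  n k -> (k, x, n) \in P -> `|coef f k n x| <= s.
Proof.
move=> satP sP s0 nk kxn.
rewrite -ler_sqr ?nnegrE// real_normK ?num_real//.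
rewrite -(ler_pM2r (@vol_gt0 R M k)); apply: le_trans (sP (k, x, n)).
rewrite mulrC -(@sum_lo R M k x) mulr_suml; apply: ler_sum => y xy.
rewrite mul1r (bigD1 k) /=; last first.
  by rewrite leqnn nk -(satP k x y n n)//; exact: hi_refl.
by rewrite (coef_lo _ _ xy) lerDl sumr_ge0// => i _; exact: sqr_ge0.
Qed.

Variables (E : {set X}) (N : X -> X) (h : X -> R).
Hypothesis h_le : forall x, `|h x| <= (x \in E)%:R.

Definition density T : R := \sum_(x | [&& inside T x, x \in E & hi (scale T).+1 (freq T) (N x)]) 1.

Definition mass_le P (mu : R) := forall T U, U \in P -> below T U ->
  density T <= mu * vol (scale T).

Lemma mass_leS P Q mu : P \subset Q -> mass_le Q mu -> mass_le P mu.
Proof. by move=> /subsetP PQ mQ T U /PQ; exact: mQ. Qed.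

(* The part of the linearized operator [f |-> W_(N x) f x] carried by the tiles in [P]. *)
Definition packet_sum P x := \sum_(k < M | N x k && ((k, x, N x) \in P))
  chr (N x) x * rad k x * coef f k (N x) x.

Definition form P := \sum_x h x * packet_sum P x.

Lemma form_split P Q : form P = form (P :\: Q) + form (P :&: Q).
Proof.
rewrite /form -big_split; apply: eq_bigr => x _ /=; rewrite -mulrDr; congr (_ * _).
rewrite /packet_sum (bigID (fun k : 'I_M => (k, x, N x) \in Q)) /= addrC; congr (_ + _).
  by apply: eq_bigl => k; rewrite inE andbA andbAC.
by apply: eq_bigl => k; rewrite inE andbA.
Qed.

(** * The estimate for a single tree *)

Section Tree.
Variables (P : {set tile}) (T : tile) (s mu : R).
Hypotheses (satP : saturated P) (PT : forall U, U \in P -> below T U).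
Hypotheses (sP : size_le P s) (mP : mass_le P mu) (s0 : 0 <= s) (mu0 : 0 <= mu).

Let xi := freq T.

(** Up to the factor [chr xi], the packets of tiles with [xi] in their upper half are Haar
    functions, that is, martingale differences. *)
Let D (k : 'I_M) x : R := if xi k && ((k, x, xi) \in P) then rad k x * coef f k xi x else 0.

Let D_lo (k : 'I_M) x y : lo k.+1 x y -> D k x = D k y.
Proof.
move=> xy; have xy' := lo_le (leqnSn k) xy.
rewrite /D (satP xy' (hi_refl _ xi)) (coef_lo _ _ xy').
by move/loP: xy => /(_ k (ltnSn k)) xyk; rewrite /rad xyk.
Qed.

Let D_flip (k : 'I_M) x : D k (flip k x) = - D k x.
Proof.
have xy : lo k (flip k x) x by rewrite lo_sym lo_flip.
rewrite /D (satP xy (hi_refl _ xi)) (coef_lo _ _ xy) rad_flip mulNr.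
by case: ifP => // _; rewrite oppr0.
Qed.

Let sum_D_sqr : \sum_x \sum_k D k x ^+ 2 <= s ^+ 2 * vol (scale T).
Proof.
apply: le_trans (sP T); rewrite [leRHS]big_mkcond; apply: ler_sum => x _ /=.
case: ifP => [Tx|/negP Tx]; last first.
  rewrite big1// => k _; rewrite /D; case: ifP => [/andP[_ /PT/and3P[_]]|]; last by rewrite expr0n.
  by move/Tx.
rewrite [leRHS]big_mkcond; apply: ler_sum => k _; rewrite /D -/xi.
have [/andP[xik kxP]|_] := boolP (xi k && ((k, x, xi) \in P)); last first.
  by rewrite expr0n /=; case: ifP => // _; exact: sqr_ge0.
have /and3P[-> _ _] /= := PT kxP.
by rewrite exprMn [rad k x ^+ 2]rad_sqr mul1r.
Qed.

Let G x := maximal D x.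

Let sum_G : \sum_(x | inside T x) G x <= 2 * s * vol (scale T).
Proof.
have v0 := @vol_ge0 R M (scale T).
have G2 : \sum_(x | inside T x) G x ^+ 2 <= 4 * (s ^+ 2 * vol (scale T)).
  apply: (@le_trans _ _ (\sum_x G x ^+ 2)).
    rewrite [leLHS]big_mkcond; apply: ler_sum => x _ /=.
    by case: ifP => // _; exact: sqr_ge0.
  apply: le_trans (doob D_lo D_flip) _.
  by rewrite (sum_partial_sqr D_lo D_flip) ler_pM2l.
rewrite -ler_sqr ?nnegrE ?mulr_ge0//; last first.
  by apply: sumr_ge0 => x _; exact: maximal_ge0.
apply: le_trans (sqr_sum_le _ _) _; rewrite sum_lo.
apply: le_trans (ler_wpM2l v0 G2) _.
by rewrite le_eqVlt; apply/orP; left; apply/eqP; ring.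
Qed.

(** [t] stops at the maximal dyadic intervals that contain no time interval of a tile of [P]: no
    tile of scale [t] or finer lives there, while the parent, if any, still contains a tile and is
    subject to the mass bound. *)
Let occupied k x := [exists U, [&& U \in P, (k <= scale U)%N & lo k x (loc U)]].
Let t := first (fun k x => ~~ occupied k x).

Let t_stopping : stopping t.
Proof.
apply: first_stopping => k x y xy; congr (~~ _).
by apply: eq_existsb => U; rewrite (lo_eql _ xy).
Qed.

Let tile_t (k : 'I_M) x n : (k, x, n) \in P -> (k < t x)%N.
Proof.
move=> kxP; rewrite ltnNge; apply/negP => tk.
have /existsP[] := first_true (leq_ltn_trans tk (ltn_ord k)).
by exists (k, x, n); rewrite kxP lo_refl !andbT; exact: tk.
Qed.

Let hit y := [&& y \in E, hi (t y) xi (N y) & (scale T < t y)%N].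

(** The parent of the stopping interval, with frequency [xi], is above some tile of [P], so its
    relative density is at most [mu]; passing to one half costs the factor 2. *)
Let avg_hit x : avg (t x) (fun y => (hit y)%:R) x <= 2 * mu.
Proof.
have [Tt|tT] := boolP (scale T < t x)%N; last first.
  rewrite (@avg_cst _ _ _ 0) ?mulr_ge0// => y xy.
  by rewrite /hit -(t_stopping xy) (negbTE tT) !andbF.
have tM : ((t x).-1 < M)%N by have := first_le (fun k x => ~~ occupied k x) x; rewrite -/(t x); lia.
have t1 : ((t x).-1.+1 = t x)%N by lia.
pose T' : tile := (Ordinal tM, x, xi).
have /negPn/existsP[U /and3P[UP tU xU]] : ~~ ~~ occupied (t x).-1 x.
  by apply: (@first_false _ (fun k x => ~~ occupied k x)); rewrite -/(t x); lia.
have := mP UP (_ : below T' U); rewrite /below tU {1}/inside /= xU.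
have /and3P[_ _ ->] := PT UP.
move=> /(_ isT) dT'; rewrite /avg mulrC ler_pdivrMr ?vol_gt0//.
have -> : 2 * mu * vol (t x) = mu * vol (t x).-1 by rewrite (volS R tM) t1; ring.
apply: le_trans dT'.
rewrite /density [leLHS]big_mkcond [leRHS]big_mkcond; apply: ler_sum => y _ /=.
rewrite /inside /= t1; case: ifP => xy; last by case: ifP.
rewrite /hit -(t_stopping xy) (lo_le _ xy) ?leq_pred//= Tt andbT.
by case: (_ && _).
Qed.

(** Tiles at [x] with [xi] in their lower half give one term at most: their scale is the highest
    digit where [xi] and [N x] differ. The other tiles form the tail of the martingale from [kap],
    the first scale at which the two frequencies share an interval; this tail is a difference of two
    partial sums. *)
Let packet_sum_le x : x \in E -> `|packet_sum P x| <= (hit x)%:R * (s + 2 * G x).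
Proof.
move=> xE; have [hx|nhx] := boolP (hit x); last first.
  rewrite mul0r /packet_sum big1 ?normr0// => k /andP[_ kxP].
  have /and3P[Tk _ Nk] := PT kxP.
  case/negP: nhx; apply/and3P; split=> //; first exact: hi_le (tile_t kxP) Nk.
  exact: leq_ltn_trans Tk (tile_t kxP).
rewrite mul1r /packet_sum (bigID (fun k : 'I_M => xi k)) /= addrC.
apply: le_trans (ler_normD _ _) _; apply: lerD.
  have [k kP|nk] := pickP (fun k : 'I_M => (N x k && ((k, x, N x) \in P)) && ~~ xi k); last first.
    by rewrite big_pred0// normr0.
  rewrite (bigD1 k)//= big1 ?addr0.
    case/andP: kP => /andP[Nk kP] _.
    rewrite normrM normrM normr_chr normr_rad !mul1r.
    exact: (coef_le_size satP sP).
  move=> l /andP[/andP[/andP[Nl lP] xil] lk]; exfalso.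
  case/andP: kP => /andP[Nk kP] xik.
  have /and3P[_ _ /hiP hk] := PT kP; have /and3P[_ _ /hiP hl] := PT lP.
  case: (ltngtP k l) => [kl|kl|/val_inj kl]; last by rewrite kl eqxx in lk.
    by move: xil; rewrite /xi hk//= Nl.
  by move: xik; rewrite /xi hl//= Nk.
have exhi : exists k, hi k xi (N x).
  by exists M; apply/hiP => i; rewrite leqNgt ltn_ord.
case: (ex_minnP exhi) => kap hkap minkap.
have kapM : (kap <= M)%N by apply: minkap; apply/hiP => i; rewrite leqNgt ltn_ord.
have -> : \sum_(k < M | N x k && ((k, x, N x) \in P) && xi k)
     chr (N x) x * rad k x * coef f k (N x) x
   = chr xi x * (partial D M x - partial D kap x).
  have -> : partial D M x - partial D kap x = \sum_(k < M | (kap <= k)%N) D k x.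
    rewrite /partial (bigID (fun k : 'I_M => (k < kap)%N)) /=.
    have -> : \sum_(i < M | (i < M)%N && (i < kap)%N) D i x = \sum_(i < M | (i < kap)%N) D i x.
      by apply: eq_bigl => i; rewrite ltn_ord.
    rewrite addrC addrK; apply: eq_bigl => i.
    by rewrite ltn_ord -leqNgt.
  rewrite mulr_sumr big_mkcond [RHS]big_mkcond /=; apply: eq_bigr => k _.
  rewrite /D; case: ifP => [/andP[/andP[Nk kP] xik]|].
    have /and3P[_ _ hk] := PT kP.
    have hkk : hi k xi (N x) by rewrite hiS /xi hk xik Nk.
    rewrite (minkap _ hkk) /= xik (satP (lo_refl k x) hk) kP /=.
    transitivity (rad k x * (chr (N x) x * coef f k (N x) x)); first by ring.
    by rewrite -(coef_hi f x hkk); ring.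
  move=> H; case: ifP => // kapk; case: ifP => [/andP[xik kP]|]; last by rewrite mulr0.
  have hkk := hi_le kapk hkap.
  have Nk : N x k by move: hkk => /hiP <-.
  move/negP: H; case; rewrite Nk xik andbT /=.
  by rewrite -(satP (lo_refl k x) (hi_le (leqnSn k) hkk)).
rewrite normrM normr_chr mul1r.
apply: le_trans (ler_normB _ _) _.
by rewrite mulr2n mulrDl mul1r lerD// le_maximal.
Qed.

(** The majorant [s + 2 * G] is constant on stopping intervals, where hits have density at most
    [2 * mu]. By Doob's inequality its sum over the time interval of [T] is at most
    [5 * s * vol (scale T)]. *)
Lemma tree_bound : `|form P| <= 10 * s * mu * vol (scale T).
Proof.
pose a x := if inside T x && (scale T < t x)%N then s + 2 * G x else 0.
have G0 x : 0 <= G x by exact: maximal_ge0.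
have a0 x : 0 <= a x by rewrite /a; case: ifP => // _; rewrite addr_ge0 ?mulr_ge0.
apply: (@le_trans _ _ (\sum_x a x * (hit x)%:R)).
  apply: le_trans (ler_norm_sum _ _ _) _; apply: ler_sum => x _.
  rewrite normrM; have [xE|xE] := boolP (x \in E); last first.
    by have := h_le x; rewrite (negbTE xE) normr_le0 => /eqP ->; rewrite normr0 mul0r mulr_ge0.
  apply: le_trans (ler_wpM2r (normr_ge0 _) (h_le x)) _; rewrite xE mul1r.
  have [Tx|Tx] := boolP (inside T x); last first.
    rewrite /packet_sum big_pred0 ?normr0 ?mulr_ge0// => k.
    apply/negP => /andP[_ /PT/and3P[_]]; by rewrite (negbTE Tx).
  apply: le_trans (packet_sum_le xE) _; rewrite mulrC /a Tx /=.
  by case: ifP => // tx; rewrite /hit tx !andbF mulr0 mul0r.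
rewrite -(@sum_avg_stopping R M t a (fun x => (hit x)%:R) t_stopping); last first.
  (* From scale [t] on all the differences [D i] vanish, so [G] only depends on the first [t x]
     digits. *)
  move=> x y xy; rewrite /a -(t_stopping xy).
  have [Tt|_] := boolP (scale T < t x)%N; last by rewrite !andbF.
  rewrite !andbT {1 2}/inside lo_sym (lo_eql _ (lo_le (ltnW Tt) xy)) lo_sym.
  case: ifP => // _; congr (_ + _ * _); apply: eq_running => l lM; apply: eq_bigr => i il.
  have [it|ti] := ltnP i (t x); first by apply: D_lo; exact: lo_le xy.
  rewrite /D.
  have [/tile_t|_] := boolP ((i, x, xi) \in P); first by rewrite ltnNge ti.
  have [/tile_t|_] := boolP ((i, y, xi) \in P); first by rewrite -(t_stopping xy) ltnNge ti.
  by rewrite andbF.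
apply: (@le_trans _ _ (\sum_x a x * (2 * mu))).
  by apply: ler_sum => x _; rewrite ler_wpM2l.
rewrite -mulr_suml.
apply: (@le_trans _ _ ((\sum_(x | inside T x) (s * 1 + 2 * G x)) * (2 * mu))).
  rewrite ler_wpM2r ?mulr_ge0// [leRHS]big_mkcond; apply: ler_sum => x _ /=.
  rewrite /a mulr1; case: (inside T x) => //=; case: ifP => // _.
  by rewrite addr_ge0 ?mulr_ge0.
rewrite big_split /= -!mulr_sumr sum_lo.
have -> : 10 * s * mu * vol (scale T) =
  (s * vol (scale T) + 2 * (2 * s * vol (scale T))) * (2 * mu) by ring.
by rewrite ler_wpM2r ?mulr_ge0// lerD2l ler_pM2l.
Qed.

End Tree.
End Forms.

Section Forests.
Variables (R : realType) (M : nat).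
Notation X := {ffun 'I_M -> bool}.
Notation vol := (@vol R M).
Notation tile := (tile M).
Implicit Types (x y z m n xi : X) (k l : nat) (i j : 'I_M) (f g a : X -> R).
Implicit Types (P Q : {set tile}) (T U : tile).
Variables (f : X -> R) (E : {set X}) (N : X -> X) (h : X -> R).
Hypothesis h_le : forall x, `|h x| <= (x \in E)%:R.
Notation density := (@density R M E N).
Notation mass_le := (@mass_le R M E N).
Notation size_le := (@size_le R M f).
Notation form := (@form R M f N h).
(** * Selecting trees *)

Definition beneath (L : seq tile) := [set U | has (fun T => below T U) L].

Lemma beneath_cons T L : beneath (T :: L) = [set U | below T U] :|: beneath L.
Proof. by apply/setP => U; rewrite !inE. Qed.

Lemma saturated_beneath L : saturated (beneath L).
Proof.
move=> k x y m n xy mn; rewrite !inE; apply: eq_has => T.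
by have := @saturated_below _ T k x y m n xy mn; rewrite !inE.
Qed.

Lemma forest_bound P L s mu : saturated P -> size_le P s -> mass_le P mu ->
  0 <= s -> 0 <= mu ->
  `|form P| <= `|form (P :\: beneath L)| +
               10 * s * mu * \sum_(T <- L) vol (scale T).
Proof.
move=> satP sP mP s0 mu0; elim: L P satP sP mP => [|T L IH] P satP sP mP.
  rewrite big_nil mulr0 addr0; suff -> : P :\: beneath [::] = P by [].
  by apply/setP => U; rewrite !inE.
rewrite (@form_split _ _ _ _ _ P [set U | below T U]) beneath_cons -setDDl.
apply: le_trans (ler_normD _ _) _.
have satT := @saturated_below M T.
have IHT := IH (P :\: [set U | below T U]) (saturatedD satP satT)
  (size_leS (subsetDl _ _) sP) (mass_leS (subsetDl _ _) mP).
rewrite big_cons mulrDr addrA [X in _ <= X]addrAC lerD//.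
apply: (tree_bound h_le) s0 mu0.
- exact: saturatedI.
- by move=> U; rewrite !inE => /andP[].
- exact: size_leS (subsetIl _ _) sP.
- exact: mass_leS (subsetIl _ _) mP.
Qed.

(** Heavy tops are selected greedily, longest time interval first, and the tiles below them removed.
    If a point of [E] were counted by two of them, the tile witnessing the later top would lie below
    the earlier one and would have been removed. So the densities add up to at most [#|E|]. *)
Lemma mass_select P mu : 0 <= mu -> exists L,
  mass_le (P :\: beneath L) mu /\ mu * \sum_(T <- L) vol (scale T) <= #|E|%:R.
Proof.
move=> mu0.
pose hit T x := [&& inside T x, x \in E & hi (scale T).+1 (freq T) (N x)].
pose heavy T := mu * vol (scale T) < density T.
suff [L [mL hL _ cL]] : exists L, [/\ mass_le (P :\: beneath L) mu,
    (forall T, T \in L -> heavy T), (forall T, T \in L -> exists2 U, U \in P & below T U) &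
    forall x, (count (hit^~ x) L <= 1)%N].
  exists L; split => //.
  apply: (@le_trans _ _ (\sum_(T <- L) density T)).
    rewrite mulr_sumr !big_seq; apply: ler_sum => T /hL; exact: ltW.
  apply: (@le_trans _ _ (\sum_x \sum_(T <- L | hit T x) 1)).
    by rewrite /density (exchange_big_dep predT).
  rewrite -sum1_card natr_sum [leRHS]big_mkcond; apply: ler_sum => x _ /=.
  case: ifP => [xE|xE].
    have -> : \sum_(T <- L | hit T x) (1 : R) = (count (hit^~ x) L)%:R.
      by rewrite -sum1_count natr_sum.
    by rewrite ler_nat; exact: cL.
  by rewrite big_pred0// => T; rewrite /hit xE andbF.
have [n] := ubnP #|P|; elim: n P => // n IH P Pn.
have [/existsP[T0 HT0]|no] :=
    boolP [exists T, heavy T && [exists U, (U \in P) && below T U]]; last first.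
  exists [::]; split => // T U; rewrite !inE /= => UP TU.
  rewrite leNgt; apply: contra no => hT; apply/existsP; exists T.
  by rewrite /heavy hT; apply/existsP; exists U; rewrite UP.
case: (@arg_minnP _ T0 (fun T => heavy T && [exists U, (U \in P) && below T U])
   (fun T => nat_of_ord (scale T)) HT0) => T /andP[hT /existsP[U /andP[UP TU]]] minT.
have [|L [mL hL bL cL]] := IH (P :\: [set U | below T U]).
  rewrite -ltnS (leq_trans _ Pn)// ltnS; apply: proper_card; apply/properP.
  by split; [exact: subsetDl|exists U => //; rewrite !inE TU].
exists (T :: L); split.
- by rewrite beneath_cons -setDDl.
- by move=> T'; rewrite inE => /orP[/eqP -> //|/hL].
- move=> T'; rewrite inE => /orP[/eqP ->|/bL[U']]; first by exists U.
  by rewrite inE => /andP[_ ?] ?; exists U'.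
move=> x /=; have [|_] := boolP (hit T x); last exact: cL.
move=> /and3P[Tx _ Nx]; rewrite add1n ltnS leqn0 -leqn0 leqNgt -has_count.
apply/hasPn => T1 T1L; apply/negP => /and3P[T1x _ T1N].
have [U1] := bL _ T1L; rewrite !inE => /andP[/negP TU1 U1P] T1U1.
have TT1 : (scale T <= scale T1)%N.
  by apply: minT; rewrite hL//; apply/existsP; exists U1; rewrite U1P.
case/and3P: T1U1 => sT1 lT1 fT1; apply: TU1; apply/and3P; split.
- exact: leq_trans sT1.
- apply: lo_trans Tx _; rewrite (lo_trans _ (lo_le TT1 lT1))//.
  by rewrite lo_sym; exact: lo_le T1x.
- have s1 : (scale T < (scale U1).+1)%N by rewrite ltnS (leq_trans TT1).
  apply: hi_trans (hi_le s1 Nx) _.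
  have s2 : (scale T1 < (scale U1).+1)%N by rewrite ltnS.
  by rewrite -(hi_eql _ (hi_le s2 T1N)).
Qed.
End Forests.

Section Orthogonality.
Variables (R : realType) (M : nat).
Notation X := {ffun 'I_M -> bool}.
Notation chr := (@chr R M).
Notation rad := (@rad R M).
Notation vol := (@vol R M).
Notation tile := (tile M).
Implicit Types (x y z m n xi : X) (k l : nat) (i j : 'I_M) (f g a : X -> R).
Implicit Types (P Q : {set tile}) (T U : tile).
Variables (f : X -> R).
Notation size_le := (@size_le R M f).
(** * Orthogonality of selected trees *)

Definition value xi : nat := (\sum_(i < M) xi i * 2 ^ i)%N.

Lemma value_low (k : nat) xi : (k <= M)%N ->
  (\sum_(i < M | (i < k)%N) xi i * 2 ^ i < 2 ^ k)%N.
Proof.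
elim: k => [|k IH] kM; first by rewrite big_pred0.
rewrite (bigD1 (Ordinal kM)) //= expnS mul2n -addnn.
rewrite (eq_bigl (fun i : 'I_M => (i < k)%N)) => [|i].
  by rewrite -addnS leq_add ?IH ?(ltnW kM)//; case: (xi _); rewrite ?mul1n ?mul0n.
by rewrite ltnS [RHS]ltn_neqAle andbC.
Qed.

Lemma value_lt (k : 'I_M) m n : ~~ m k -> n k -> hi k.+1 m n -> (value m < value n)%N.
Proof.
move=> mk nk /hiP mn; rewrite /value (bigID (fun i : 'I_M => (i < k)%N)) /=.
rewrite [ltnRHS](bigID (fun i : 'I_M => (i < k)%N)) /= addnC [ltnRHS]addnC.
rewrite [X in (X + _ < _)%N](bigD1 k) ?ltnn//= [X in (_ < X + _)%N](bigD1 k) ?ltnn//=.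
rewrite (negbTE mk) nk mul0n mul1n add0n.
rewrite (eq_bigr (fun i => n i * 2 ^ i)%N) => [|i /andP[ik ki]]; last first.
  by rewrite mn// ltn_neqAle eq_sym ki leqNgt.
rewrite [X in (_ < X + _)%N]addnC -addnA ltn_add2l ltn_addr//.
exact: value_low (ltnW (ltn_ord k)).
Qed.

Definition active T Q (k : 'I_M) x :=
  [&& inside T x, (scale T <= k)%N, freq T k & (k, x, freq T) \in Q].

Definition packet T Q (k : 'I_M) x : R :=
  if active T Q k x then chr (freq T) x * rad k x * coef f k (freq T) x else 0.

Definition packets T Q x : R := \sum_k packet T Q k x.

(** The left side of [size_le]; for saturated [Q] it is the squared norm of [packets T Q], a
    projection of [f]. *)
Definition energy T Q : R :=
  \sum_(x | inside T x) \sum_(k < M |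
     [&& (scale T <= k)%N, freq T k & (k, x, freq T) \in Q])
    coef f k (freq T) x ^+ 2.

Lemma energy_active T Q :
  energy T Q = \sum_(k < M) \sum_(x | active T Q k x) coef f k (freq T) x ^+ 2.
Proof.
rewrite /energy big_mkcond [RHS](exchange_big_dep predT)//=.
apply: eq_bigr => x _; rewrite /active; case: ifP => // _.
by rewrite big_pred0.
Qed.

Lemma energy_subset T P Q : P \subset Q -> energy T P <= energy T Q.
Proof.
move=> PQ; apply: ler_sum => x _.
rewrite [leLHS]big_mkcond [leRHS]big_mkcond; apply: ler_sum => k _ /=.
case: ifP => [/and3P[-> -> /(subsetP PQ) ->]//|_].
by case: ifP => // _; exact: sqr_ge0.
Qed.

Lemma active_lo T Q (k : 'I_M) x y : saturated Q -> lo k x y ->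
  active T Q k x = active T Q k y.
Proof.
move=> satQ xy; rewrite /active (satQ _ _ _ _ _ xy (hi_refl _ _)).
case: (leqP (scale T) k) => Tk; last by rewrite !andbF.
by rewrite /inside lo_sym (lo_eql _ (lo_le Tk xy)) lo_sym.
Qed.

Lemma packet_flip T Q (k i : 'I_M) x : saturated Q -> (k <= i)%N ->
  packet T Q k (flip i x) = (-1) ^+ (freq T i (+) (i == k)) * packet T Q k x.
Proof.
move=> satQ ki; have xy := lo_flip x ki.
rewrite /packet -(active_lo _ satQ xy); case: ifP; last by rewrite mulr0.
rewrite -(coef_lo _ _ xy) chr_flip signr_addb => _.
have [->|ik] := eqVneq i k; first by rewrite rad_flip; ring.
by rewrite rad_flip_neq 1?eq_sym//; ring.
Qed.

(** The boolean condition says that flipping digit [i] changes the sign of exactly one of the two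
    packets; [i == k] accounts for the Rademacher factor. *)
Lemma sum_packet_flip T T' Q Q' (k k' i : 'I_M) : saturated Q -> saturated Q' ->
  (k <= i)%N -> (k' <= i)%N -> freq T i (+) (i == k) (+) freq T' i (+) (i == k') ->
  \sum_x packet T Q k x * packet T' Q' k' x = 0.
Proof.
move=> satQ satQ' ki ki' odd_i; apply: (@sum_flip_eq0 _ _ i) => x.
rewrite !packet_flip// mulrACA -signr_addb addbA odd_i expr1.
by rewrite mulN1r.
Qed.

Lemma sum_packet_inactive T T' Q Q' (k k' : 'I_M) :
  (forall x, ~~ (active T Q k x && active T' Q' k' x)) ->
  \sum_x packet T Q k x * packet T' Q' k' x = 0.
Proof.
move=> na; apply: big1 => x _; rewrite /packet; have := na x.
by case: (active T Q k x); case: (active T' Q' k' x) => //=; rewrite ?mulr0 ?mul0r.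
Qed.

(* Trees are selected by increasing frequency, so that the lower halves of tiles in
   distinct selected trees are disjoint. *)
Lemma packets_orthogonal T T' Q Q' : saturated Q -> saturated Q' ->
  (forall U, U \in Q' -> ~~ below T U) -> (value (freq T) <= value (freq T'))%N ->
  \sum_x packets T Q x * packets T' Q' x = 0.
Proof.
move=> satQ satQ' nb vTT'.
rewrite /packets; under eq_bigr do rewrite big_distrlr /=.
rewrite exchange_big big1//= => k _; rewrite exchange_big big1//= => k' _.
have [/existsP[x /andP[]]|] :=
    boolP [exists x, active T Q k x && active T' Q' k' x]; last first.
  by move=> /existsPn na; exact: sum_packet_inactive.
move=> /and4P[Tx Tk fk _] /and4P[T'x T'k' f'k' k'Q'].
have [/existsP[i /and3P[ki ki' fi]]|] :=
    boolP [exists i : 'I_M, [&& (k < i)%N, (k' < i)%N & freq T i != freq T' i]].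
  apply: (@sum_packet_flip _ _ _ _ k k' i) => //; [exact: ltnW|exact: ltnW|].
  have -> : (i == k) = false by apply/negbTE; apply: contraTneq ki => ->; rewrite ltnn.
  have -> : (i == k') = false by apply/negbTE; apply: contraTneq ki' => ->; rewrite ltnn.
  by move: fi; rewrite !addbF; case: (freq T i) (freq T' i) => [] [].
move=> /existsPn agree.
have agreeP i : (k < i)%N -> (k' < i)%N -> freq T i = freq T' i.
  by move=> ki ki'; apply/eqP; have := agree i; rewrite ki ki' negbK.
(* The frequencies now agree above both scales. Unless the signs at the larger scale give
   cancellation, either a tile of [Q'] lies below [T] or the order of the top frequencies is
   violated. *)
case: (ltngtP k k') => kk'.
- have [fk'|fk'] := boolP (freq T k').
    apply: (@sum_packet_flip _ _ _ _ k k' k') => //; first exact: ltnW.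
    rewrite fk' f'k' eqxx; have -> // : (k' == k) = false.
    by apply/negbTE; apply: contraTneq kk' => ->; rewrite ltnn.
  case/negP: (nb _ k'Q'); apply/and3P; split.
  + exact: leq_trans Tk (ltnW kk').
  + exact: Tx.
  + by apply/hiP => i ki; apply: agreeP => //; exact: ltn_trans kk' _.
- have [f'k|f'k] := boolP (freq T' k).
    apply: (@sum_packet_flip _ _ _ _ k k' k) => //; first exact: ltnW.
    rewrite fk f'k eqxx; have -> // : (k == k') = false.
    by apply/negbTE; apply: contraTneq kk' => ->; rewrite ltnn.
  have : (value (freq T') < value (freq T))%N.
    apply: value_lt f'k fk _; rewrite hi_sym; apply/hiP => i ki; apply: agreeP => //.
    exact: ltn_trans kk' _.
  by rewrite ltnNge vTT'.
- case/negP: (nb _ k'Q'); apply/and3P; split => //; first by rewrite -kk'.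
  by apply/hiP => i ki; apply: agreeP; rewrite ?kk'.
Qed.

Lemma sum_packets_sqr T Q : saturated Q -> \sum_x packets T Q x ^+ 2 = energy T Q.
Proof.
move=> satQ; rewrite energy_active.
under eq_bigr do rewrite expr2 big_distrlr /=.
rewrite exchange_big; apply: eq_bigr => k _; rewrite exchange_big /=.
rewrite (bigD1 k)//= [X in _ + X]big1 ?addr0 => [|k' kk'].
  rewrite [RHS]big_mkcond; apply: eq_bigr => x _; rewrite /packet; case: ifP; last by rewrite mulr0.
  move=> _; transitivity ((chr (freq T) x * chr (freq T) x) * (rad k x * rad k x) *
    coef f k (freq T) x ^+ 2).
    by ring.
  by rewrite chr_sqr rad_sqr !mul1r.
have [/existsP[x /andP[]]|] :=
    boolP [exists x, active T Q k x && active T Q k' x]; last first.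
  by move=> /existsPn na; exact: sum_packet_inactive.
move=> /and4P[_ _ fk _] /and4P[_ _ fk' _].
case: (ltngtP k k') => lt.
- apply: (@sum_packet_flip _ _ _ _ k k' k') => //; first exact: ltnW.
  by rewrite fk' eqxx (negbTE kk').
- apply: (@sum_packet_flip _ _ _ _ k k' k) => //; first exact: ltnW.
  by rewrite fk eqxx eq_sym (negbTE kk').
- by rewrite (val_inj lt) eqxx in kk'.
Qed.

Lemma sum_f_packets T Q : saturated Q -> \sum_x f x * packets T Q x = energy T Q.
Proof.
move=> satQ; rewrite energy_active; under eq_bigr do rewrite mulr_sumr.
rewrite exchange_big; apply: eq_bigr => k _ /=.
pose a x := if active T Q k x then coef f k (freq T) x else 0.
transitivity (\sum_x a x * (f x * chr (freq T) x * rad k x)).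
  apply: eq_bigr => x _; rewrite /packet /a; case: ifP => _; last by rewrite mulr0 mul0r.
  by ring.
rewrite -(@sum_avg _ _ k) => [|x y xy]; last by rewrite /a (active_lo _ satQ xy) (coef_lo _ _ xy).
rewrite [RHS]big_mkcond; apply: eq_bigr => x _; rewrite /a; case: ifP => _; last by rewrite mul0r.
by rewrite expr2.
Qed.

Implicit Types (L : seq (tile * {set tile})) (b : tile * {set tile}).

Definition synthesis L x := \sum_(b <- L) packets b.1 b.2 x.

(** While some top violates the size bound, the one of least frequency is selected and the tiles
    below it are removed. The second component of an entry records the tiles present at that moment,
    so [packets_orthogonal] applies to it and every later entry, and the squared norms add up. *)
Lemma size_trees P s : saturated P -> exists L,
  [/\ size_le (P :\: beneath [seq b.1 | b <- L]) s,
      forall b, b \in L -> [/\ s ^+ 2 * vol (scale b.1) < energy b.1 b.2,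
                              saturated b.2 & b.2 \subset P] &
      \sum_x synthesis L x ^+ 2 = \sum_(b <- L) energy b.1 b.2].
Proof.
have [n] := ubnP #|P|; elim: n P => // n IH P Pn satP.
pose heavy T := s ^+ 2 * vol (scale T) < energy T P.
have [/existsP[T0 HT0]|/existsPn no] := boolP [exists T, heavy T]; last first.
  exists [::]; split => //.
    move=> T; rewrite leNgt; apply: contra (no T) => /lt_le_trans; apply.
    by apply: energy_subset; exact: subsetDl.
  by rewrite big_nil big1// => x _; rewrite /synthesis big_nil expr0n.
case: (@arg_minnP _ T0 heavy (fun T => value (freq T)) HT0) => T hT minT.
have satP1 : saturated (P :\: [set U | below T U]).
  by apply: saturatedD => //; exact: saturated_below.
have [||L [sL hL oL]] := IH (P :\: [set U | below T U]).
- rewrite -ltnS (leq_trans _ Pn)// ltnS; apply: proper_card; apply/properP.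
  split; first exact: subsetDl.
  apply/exists_inP; apply: contraTT hT => /exists_inPn noU; rewrite -leNgt.
  rewrite /energy big1 => [|x Tx]; first exact: mulr_ge0 (sqr_ge0 _) (vol_ge0 _ _ _).
  rewrite big_pred0// => k; apply/negP => /and3P[Tk _ kP].
  by have := noU _ kP; rewrite !inE kP andbT /below /= hi_refl Tk Tx.
- exact: satP1.
exists ((T, P) :: L); split.
- by rewrite /= beneath_cons -setDDl.
- move=> b; rewrite inE => /orP[/eqP ->|/hL [? ? bP]]; first by split.
  by split=> //; exact: subset_trans bP (subsetDl _ _).
rewrite big_cons /= -oL -(sum_packets_sqr T satP).
have cross : \sum_x packets T P x * synthesis L x = 0.
  rewrite /synthesis; under eq_bigr do rewrite mulr_sumr.
  rewrite exchange_big big_seq big1// => b bL; have [hb satb bP] := hL _ bL.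
  apply: packets_orthogonal => //.
    by move=> U /(subsetP bP); rewrite !inE => /andP[].
  apply: minT; apply: lt_le_trans hb _; apply: energy_subset.
  exact: subset_trans bP (subsetDl _ _).
transitivity (\sum_x (packets T P x ^+ 2 +
    (synthesis L x ^+ 2 + 2 * (packets T P x * synthesis L x)))).
  by apply: eq_bigr => x _; rewrite /synthesis big_cons /=; ring.
by rewrite !big_split /= -mulr_sumr cross mulr0 addr0.
Qed.
End Orthogonality.

Section MultiFrequency.
Variables (R : realType) (M : nat).
Notation X := {ffun 'I_M -> bool}.
Notation chr := (@chr R M).
Notation rad := (@rad R M).
Notation vol := (@vol R M).
Notation tile := (tile M).
Implicit Types (x y z m n xi : X) (k l : nat) (i j : 'I_M) (f g a : X -> R).
Implicit Types (P Q : {set tile}) (T U : tile).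
Variables (f : X -> R).
Notation packets := (@packets R M f).
Notation energy := (@energy R M f).
Notation synthesis := (@synthesis R M f).
Implicit Types (L : seq (tile * {set tile})) (b : tile * {set tile}).
(** * The multi-frequency energy estimate *)

Lemma avg_flip_eq0 k i g x : (k <= i)%N -> (forall y, g (flip i y) = - g y) ->
  avg k g x = 0.
Proof.
move=> ki gN; rewrite /avg big_mkcond /= (@sum_flip_eq0 _ _ i) ?mulr0// => y.
have -> : lo k x (flip i y) = lo k x y.
  by rewrite lo_sym [RHS]lo_sym; apply/esym/lo_eql/lo_flip.
by case: ifP => // _; rewrite oppr0.
Qed.

(* The dichotomy [a <= sqrt n] or [a > sqrt n] replaces the interpolation between
   [L^2] and [L^oo] bounds for exponential sums with [n] frequencies. *)
Lemma young_split (p a b V n : R) : 1 < p -> p <= 2 -> 0 <= a -> 0 <= b -> 0 <= V ->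
  1 <= n -> b ^+ 2 <= n * V ->
  a * b <= a `^ p * Num.sqrt n `^ (2 - p) + b ^+ 2 / 4 +
           a `^ p * Num.sqrt n `^ (2 - p) * Num.sqrt V.
Proof.
move=> p1 p2 a0 b0 V0 n1 bV; set r := Num.sqrt n; set w := r `^ (2 - p).
have r1 : 1 <= r by rewrite -(sqrtr1 R) ler_sqrt// (le_trans ler01 n1).
have r0 : 0 < r by exact: lt_le_trans r1.
have w0 : 0 <= w by exact: powR_ge0.
have v0 := sqrtr_ge0 V; set v := Num.sqrt V in v0 *.
have ap0 := powR_ge0 a p.
have [ar|ra] := leP a r.
  have : a ^+ 2 <= a `^ p * w.
    have [->|aN0] := eqVneq a 0; first by rewrite expr0n mulr_ge0 ?powR_ge0.
    have -> : a ^+ 2 = a `^ p * a `^ (2 - p).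
      by rewrite -powRD ?aN0 ?implybT// -powR_mulrn//; congr (_ `^ _); ring.
    by rewrite ler_wpM2l// ge0_ler_powR ?nnegrE ?subr_ge0 ?(ltW r0).
  have := sqr_ge0 (a - b / 2).
  have : 0 <= a `^ p * w * v by rewrite !mulr_ge0.
  by nra.
have aN0 : a != 0 by rewrite gt_eqF// (lt_trans r0).
have bv : b <= r * v.
  rewrite -ler_sqr ?nnegrE ?mulr_ge0 ?(ltW r0)// exprMn !sqr_sqrtr//.
  exact: le_trans n1.
have rw : r <= a `^ (p - 1) * w.
  have {1}-> : r = r `^ (p - 1) * r `^ (2 - p).
    rewrite -powRD ?(gt_eqF r0) ?implybT//.
    by rewrite (_ : p - 1 + (2 - p) = 1) ?powRr1 ?ltW//; ring.
  rewrite ler_wpM2r// ge0_ler_powR ?nnegrE ?(ltW r0) ?(ltW ra)//.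
  by rewrite subr_ge0 ltW.
have ap : a `^ p = a * a `^ (p - 1).
  by rewrite -[X in X * _]powRr1// -powRD ?aN0 ?implybT//; congr (_ `^ _); ring.
have : a * b <= a * (r * v) by rewrite ler_wpM2l.
have : a * (r * v) <= a * (a `^ (p - 1) * w * v) by rewrite ler_wpM2l// ler_wpM2r.
rewrite ap => h1 h2.
have : 0 <= a * a `^ (p - 1) * w by rewrite -ap mulr_ge0.
have := sqr_ge0 b.
have -> : a * a `^ (p - 1) * w * v = a * (a `^ (p - 1) * w * v) by ring.
lra.
Qed.

Variable p : R.
Hypotheses (p1 : 1 < p) (p2 : p <= 2).

Definition fp x : R := `|f x| `^ p.

Lemma fp_ge0 x : 0 <= fp x.
Proof. exact: powR_ge0. Qed.

(* Calderon-Zygmund stopping rule at height 1 for [|f| ^ p]. *)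
Definition good k x := [forall l : 'I_M.+1, (l <= k)%N ==> (avg l fp x <= 1)].

Lemma goodP k x : (k <= M)%N ->
  reflect (forall l, (l <= k)%N -> avg l fp x <= 1) (good k x).
Proof.
move=> kM; apply: (iffP forallP) => [h l lk|h l]; last by apply/implyP => /h.
have lM : (l < M.+1)%N by rewrite ltnS (leq_trans lk).
by have /implyP := h (Ordinal lM); apply.
Qed.

Lemma good_lo k x y : (k <= M)%N -> lo k x y -> good k x = good k y.
Proof.
move=> kM xy; apply/goodP/goodP => // h l lk.
  by rewrite -(avg_lo _ (lo_le lk xy)) h.
by rewrite (avg_lo _ (lo_le lk xy)) h.
Qed.

(** [minn k M] keeps the level in the range covered by [good_lo]; [first] only tests levels below
    [M]. *)
Definition stop := first (fun k x => ~~ good (minn k M) x).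

Lemma stop_stopping : stopping stop.
Proof.
apply: first_stopping => k x y xy; congr (~~ _).
by apply: good_lo; rewrite ?geq_minr//; apply: lo_le xy; exact: geq_minl.
Qed.

Lemma good_stop (k : 'I_M) x : good k x -> (k < stop x)%N.
Proof.
move=> gk; rewrite ltnNge; apply/negP => sk.
have sM := leq_ltn_trans sk (ltn_ord k).
have := first_true sM; rewrite -/(stop x) (minn_idPl (ltnW sM)) => /negP; apply.
apply/goodP => [|l ls]; first exact: ltnW.
have /goodP := gk; apply; [exact: ltnW|exact: leq_trans sk].
Qed.

Hypothesis root_le1 : forall x, avg 0 fp x <= 1.

(** The parent of a stopping interval is good, and halving an interval at most doubles the average;
    level 0 is covered by [root_le1]. *)
Lemma avg_stop x : avg (stop x) fp x <= 2.
Proof.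
have := first_le (fun k x => ~~ good (minn k M) x) x; rewrite -/stop.
case E : (stop x) => [|k] sM; first by have := root_le1 x; lra.
have : ~~ ~~ good (minn k M) x.
  by apply: (@first_false _ (fun k x => ~~ good (minn k M) x)); rewrite -/(stop x) E.
rewrite negbK (minn_idPl (ltnW sM)) => /(goodP _ (ltnW sM))/(_ k (leqnn k)) h.
have := @avgS_le _ _ k fp x fp_ge0; lra.
Qed.

Definition good_tiles := [set U : tile | good (scale U) (loc U)].

Lemma saturated_good : saturated good_tiles.
Proof.
move=> k x y m n xy _; rewrite !inE /scale /loc /=.
by apply: good_lo => //; exact: ltnW.
Qed.

(** Requiring a scale below [stop x] makes the number of these trees constant on each stopping
    interval. *)
Definition meets x b := inside b.1 x && (scale b.1 < stop x)%N.
Definition multiplicity L x := count (meets x) L.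

Lemma multiplicity_stop L x y : lo (stop x) x y -> multiplicity L x = multiplicity L y.
Proof.
move=> xy; apply: eq_count => b; rewrite /meets -(stop_stopping xy).
have [bs|] := boolP (scale b.1 < stop x)%N; last by rewrite !andbF.
by rewrite !andbT /inside lo_sym (lo_eql _ (lo_le (ltnW bs) xy)) lo_sym.
Qed.

Section Family.
Variable L : seq (tile * {set tile}).
Hypothesis satL : forall b, b \in L -> saturated b.2.
Hypothesis goodL : forall b, b \in L -> b.2 \subset good_tiles.

Lemma active_stop b (k : 'I_M) x : b \in L -> active b.1 b.2 k x -> (k < stop x)%N.
Proof.
by move=> bL /and4P[_ _ _ /(subsetP (goodL bL))]; rewrite inE; exact: good_stop.
Qed.

(** Good tiles at [x] have scale below [stop x], so on the stopping interval all factors except the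
    character are constant. *)
Lemma packets_stop b x y : b \in L -> lo (stop x) x y ->
  packets b.1 b.2 y =
  chr (freq b.1) y * chr (freq b.1) x * packets b.1 b.2 x.
Proof.
move=> bL xy; rewrite /packets mulr_sumr; apply: eq_bigr => k _.
have Ek : active b.1 b.2 k x = active b.1 b.2 k y.
  have [ks|sk] := ltnP k (stop x).
    by apply: active_lo (satL bL) _; exact: lo_le (ltnW ks) xy.
  apply/idP/idP => /(active_stop bL); first by rewrite ltnNge sk.
  by rewrite -(stop_stopping xy) ltnNge sk.
rewrite /packet -Ek; case: ifP => [akx|_]; last by rewrite mulr0.
have ks := active_stop bL akx.
rewrite (coef_lo _ _ (lo_le (ltnW ks) xy)).
have -> : rad k y = rad k x by move/loP: xy => /(_ _ ks); rewrite /rad => ->.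
transitivity ((chr (freq b.1) x * chr (freq b.1) x) *
    (chr (freq b.1) y * rad k x * coef f k (freq b.1) y)); last by ring.
by rewrite chr_sqr mul1r.
Qed.

Lemma packets_meets b x : b \in L -> ~~ meets x b -> packets b.1 b.2 x = 0.
Proof.
move=> bL nm; rewrite /packets big1// => k _; rewrite /packet; case: ifP => // akx.
have ks := active_stop bL akx; case/and4P: akx => bx bk _ _.
by case/negP: nm; rewrite /meets bx (leq_ltn_trans bk).
Qed.

(* On a stopping interval the synthesis is an exponential sum whose number of distinct
   frequencies is at most the multiplicity. *)
Lemma synthesis_sqr_le x y : lo (stop x) x y ->
  synthesis L y ^+ 2 <= (multiplicity L x)%:R * avg (stop x) (fun z => synthesis L z ^+ 2) x.
Proof.
set t := stop x => xy.
(* On the interval, the digits below [t] change a character only by a constant, while characters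
   with distinct truncated frequencies are orthogonal there. *)
pose rep xi : X := [ffun i : 'I_M => (t <= i)%N && xi i].
have rep_hi xi : hi t xi (rep xi) by apply/hiP => i ti; rewrite ffunE ti.
pose S : {set X} := [set m in [seq rep (freq b.1) | b <- L & meets x b]].
have cS : (#|S| <= multiplicity L x)%N.
  rewrite cardsE (leq_trans (card_size _))// size_map size_filter; exact: leqnn.
pose d m := \sum_(b <- L | meets x b && (rep (freq b.1) == m)) chr m x * packets b.1 b.2 x.
have synE z : lo t x z -> synthesis L z = \sum_(m in S) d m * chr m z.
  move=> xz; rewrite /synthesis.
  transitivity (\sum_(b <- L | meets x b)
     chr (rep (freq b.1)) x * packets b.1 b.2 x * chr (rep (freq b.1)) z).
    rewrite [RHS]big_mkcond !big_seq; apply: eq_bigr => b bL.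
    rewrite (packets_stop bL xz); case: ifP => [_|/negbT nm].
      rewrite [chr _ z * _]mulrC (chr_pair R (rep_hi (freq b.1)) xz); ring.
    by rewrite (packets_meets bL nm) mulr0.
  rewrite big_seq_cond (partition_big (fun b => rep (freq b.1)) (mem S)) /=; last first.
    by move=> b /andP[bL mb]; rewrite !inE; apply/mapP; exists b; rewrite // mem_filter mb.
  apply: eq_bigr => m _; rewrite /d mulr_suml [RHS]big_seq_cond.
  apply: eq_big => b; first by rewrite andbA.
  by move=> /andP[_ /eqP ->].
rewrite (synE y xy); apply: le_trans (sqr_sum_le _ _) _.
have -> : \sum_(m in S) (d m * chr m y) ^+ 2 = \sum_(m in S) d m ^+ 2.
  by apply: eq_bigr => m _; rewrite exprMn [chr m y ^+ 2]chr_sqr mulr1.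
have -> : avg t (fun z => synthesis L z ^+ 2) x = \sum_(m in S) d m ^+ 2.
  rewrite (@avg_ext _ _ t _ (fun z =>
    \sum_(m in S) \sum_(n in S) d m * d n * (chr m z * chr n z))); last first.
    move=> z xz; rewrite (synE z xz) expr2 big_distrlr /=.
    by apply: eq_bigr => m _; apply: eq_bigr => n _; ring.
  rewrite avg_sum; apply: eq_bigr => m mS; rewrite avg_sum (bigD1 m)//= avgZ.
  rewrite (@avg_cst _ _ _ 1) => [|z _]; last exact: chr_sqr.
  rewrite mulr1 big1 ?addr0 -?expr2// => n /andP[nS nm]; rewrite avgZ.
  suff [i [ti mn]] : exists i : 'I_M, (t <= i)%N /\ m i != n i.
    rewrite (@avg_flip_eq0 _ i) ?mulr0// => z; rewrite !chr_flip.
    by move: mn; case: (m i) (n i) => [] []// _; rewrite ?expr0 ?expr1; ring.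
  have /existsP[i mni] : [exists i, m i != n i].
    apply: contraNT nm; rewrite negb_exists => /forallP e; apply/eqP/ffunP => i.
    by have := e i; rewrite negbK => /eqP ->.
  exists i; split => //; rewrite leqNgt; apply: contra mni => it.
  move: mS nS; rewrite !inE => /mapP[b _ ->] /mapP[b' _ ->].
  by rewrite !ffunE leqNgt it.
rewrite ler_wpM2r ?sumr_ge0// => [m _|]; first exact: sqr_ge0.
by rewrite sumr_const ler_nat.
Qed.

(** [S] is both the squared norm of the synthesis and its pairing with [f]. On each stopping
    interval [young_split], with [n] the multiplicity, bounds the pairing; absorbing half of [S]
    turns the constant 3 into 6. *)
Lemma energy_le : \sum_x synthesis L x ^+ 2 = \sum_(b <- L) energy b.1 b.2 ->
  \sum_(b <- L) energy b.1 b.2 <=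
  6 * \sum_x fp x * ((multiplicity L x)%:R * (multiplicity L x)%:R `^ (1 - p)).
Proof.
move=> orth; set S := \sum_(b <- L) _ in orth *.
pose mul x : R := (multiplicity L x)%:R * (multiplicity L x)%:R `^ (1 - p).
have SE : S = \sum_x f x * synthesis L x.
  rewrite /S big_seq; under eq_bigr => b bL do rewrite -(sum_f_packets f b.1 (satL bL)).
  rewrite -big_seq exchange_big; apply: eq_bigr => x _ /=.
  by rewrite /synthesis mulr_sumr.
suff leaf x : avg (stop x) (fun y => `|f y| * `|synthesis L y|) x <=
   avg (stop x) (fun y => synthesis L y ^+ 2) x * 2^-1 + 3 * (mul x * avg (stop x) fp x).
  have sumE g : \sum_x avg (stop x) g x = \sum_x g x.
    have := @sum_avg_stopping R M stop (fun=> 1) g stop_stopping (fun _ _ _ => erefl).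
    by under eq_bigr do rewrite mul1r; under [in RHS]eq_bigr do rewrite mul1r.
  have : S <= S * 2^-1 + 3 * \sum_x fp x * mul x; last by lra.
  rewrite {1}SE -{1}orth.
  apply: (@le_trans _ _ (\sum_x `|f x| * `|synthesis L x|)).
    by apply: ler_sum => x _; rewrite -normrM ler_norm.
  rewrite -sumE; apply: (le_trans (ler_sum _ (fun x _ => leaf x))).
  rewrite big_split /= -mulr_suml sumE lerD2l -mulr_sumr ler_wpM2l//.
  rewrite (@sum_avg_stopping _ _ stop mul fp stop_stopping).
    by apply: ler_sum => x _; rewrite mulrC.
  by move=> y z yz; rewrite /mul (multiplicity_stop L yz).
set t := stop x; set V := avg t (fun y => synthesis L y ^+ 2) x.
have V0 : 0 <= V by apply: avg_ge0 => y; exact: sqr_ge0.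
have m0 : 0 <= mul x by rewrite mulr_ge0 ?powR_ge0.
have A0 : 0 <= avg t fp x by apply: avg_ge0; exact: fp_ge0.
have A2 := avg_stop x; rewrite -/t in A2.
(* With no tree over the interval the synthesis vanishes there, whereas [young_split] asks for
   [1 <= n]. *)
have [n0|n0] := eqVneq (multiplicity L x) 0%N.
  rewrite (@avg_cst _ _ _ 0) => [|y xy].
    apply: addr_ge0; first by apply: mulr_ge0; rewrite // invr_ge0.
    by apply: mulr_ge0 => //; apply: mulr_ge0.
  have := synthesis_sqr_le xy; rewrite n0 mul0r.
  rewrite real_exprn_even_le0 ?num_real//= => /eqP ->; by rewrite normr0 mulr0.
have n1 : 1 <= (multiplicity L x)%:R :> R by rewrite ler1n lt0n.
set n := (multiplicity L x)%:R in n1.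
have n_gt0 : 0 < n by exact: lt_le_trans n1.
set w := Num.sqrt n `^ (2 - p).
have w2 : w ^+ 2 = mul x.
  rewrite /mul -/n expr2 /w -powRM ?sqrtr_ge0// -expr2 sqr_sqrtr ?(ltW n_gt0)//.
  rewrite -[X in X * _]powRr1 ?(ltW n_gt0)// -powRD ?(gt_eqF n_gt0) ?implybT//.
  by congr (_ `^ _); ring.
have w0 : 0 <= w by exact: powR_ge0.
have w1 : 1 <= w.
  have {1}-> : 1 = 1 `^ (2 - p) by rewrite powR1.
  rewrite ge0_ler_powR ?nnegrE ?subr_ge0 ?sqrtr_ge0//.
  by rewrite -(sqrtr1 R) ler_sqrt// ltW.
apply: (@le_trans _ _ (avg t (fun y => w * (1 + Num.sqrt V) * fp y + 4^-1 * synthesis L y ^+ 2) x)).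
  apply: ler_avg => y xy.
  have := @young_split p `|f y| `|synthesis L y| V n p1 p2 (normr_ge0 _) (normr_ge0 _) V0 n1.
  rewrite real_normK ?num_real// => /(_ (synthesis_sqr_le xy)).
  rewrite -/w -/(fp y); move/le_trans; apply.
  by rewrite le_eqVlt; apply/orP; left; apply/eqP; field.
rewrite avgD !avgZ -/V -w2.
move: (avg t fp x) A0 A2 => A A0 A2.
have vV : Num.sqrt V ^+ 2 = V by exact: sqr_sqrtr.
have v0 := sqrtr_ge0 V; move: (Num.sqrt V) vV v0 => v vV v0.
rewrite -vV.
have h1 : w * A <= w ^+ 2 * A by rewrite ler_wpM2r// expr2 ler_peMl.
(* One factor of [A ^+ 2] is bounded by 2 through [avg_stop]; together with [h1] this gives the
   constant [1 + 2 = 3]. *)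
have h2 : A ^+ 2 * w ^+ 2 <= 2 * A * w ^+ 2 by rewrite ler_wpM2r ?sqr_ge0// expr2 ler_wpM2r.
have := sqr_ge0 (v / 2 - A * w).
nra.
Qed.

Lemma sum_fp_multiplicity :
  \sum_x fp x * (multiplicity L x)%:R <= 2 * \sum_(b <- L) vol (scale b.1).
Proof.
under eq_bigr do rewrite mulrC.
rewrite -(@sum_avg_stopping _ _ stop _ fp stop_stopping); last first.
  by move=> x y xy; rewrite (multiplicity_stop L xy).
apply: (@le_trans _ _ (\sum_x (multiplicity L x)%:R * 2)).
  by apply: ler_sum => x _; rewrite ler_wpM2l// avg_stop.
rewrite -mulr_suml mulrC ler_wpM2l//.
apply: (@le_trans _ _ (\sum_x \sum_(b <- L) (if inside b.1 x then 1 else 0))).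
  apply: ler_sum => x _; rewrite /multiplicity -sum1_count natr_sum big_mkcond /=.
  by apply: ler_sum => b _; rewrite /meets; case: (inside _ _) => //=; case: ifP.
by rewrite exchange_big /=; apply: ler_sum => b _; rewrite -big_mkcond sum_lo.
Qed.

End Family.
End MultiFrequency.

Section Decomposition.
Variables (R : realType) (M : nat).
Notation X := {ffun 'I_M -> bool}.
Notation vol := (@vol R M).
Notation tile := (tile M).
Implicit Types (x y z m n xi : X) (k l : nat) (i j : 'I_M) (f g a : X -> R).
Implicit Types (P Q : {set tile}) (T U : tile).
Variables (f : X -> R).
Notation size_le := (@size_le R M f).
Notation energy := (@energy R M f).
Notation synthesis := (@synthesis R M f).
Implicit Types (L : seq (tile * {set tile})) (b : tile * {set tile}).
Variable p : R.
Hypotheses (p1 : 1 < p) (p2 : p <= 2).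
Notation fp := (@fp R M f p).
Notation good_tiles := (@good_tiles R M f p).
Hypothesis root_le1 : forall x, avg 0 fp x <= 1.
(** * The weak-type bound in the finite model *)

(** A single tree has multiplicity at most 1, so its energy is even at most [12 * vol (scale T)]; 24
    is the constant of [size_select]. *)
Lemma size_good P : saturated P -> P \subset good_tiles -> size_le P (Num.sqrt 24).
Proof.
move=> satP goodP T; rewrite sqr_sqrtr// -[leLHS]/(energy T P).
have sat b : b \in [:: (T, P)] -> saturated b.2 by rewrite inE => /eqP ->.
have gd b : b \in [:: (T, P)] -> b.2 \subset good_tiles by rewrite inE => /eqP ->.
have := energy_le p1 p2 root_le1 sat gd; rewrite big_seq1 => H.
apply: le_trans (H _) _.
  rewrite -(sum_packets_sqr f T satP); apply: eq_bigr => x _.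
  by rewrite /synthesis big_seq1.
have := sum_fp_multiplicity root_le1 [:: (T, P)].
rewrite big_seq1 /= => h2.
have -> : \sum_x fp x * ((multiplicity f p [:: (T, P)] x)%:R *
     (multiplicity f p [:: (T, P)] x)%:R `^ (1 - p)) =
   \sum_x fp x * (multiplicity f p [:: (T, P)] x)%:R.
  apply: eq_bigr => x _; rewrite /multiplicity /= addn0.
  by case: (meets _ _ _ _); rewrite /= ?powR1 ?mulr1 ?mul0r.
have := @vol_ge0 R M (scale T); lra.
Qed.

Lemma powR_split (n n0 : R) : 0 <= n -> 0 < n0 ->
  n * n `^ (1 - p) <= n0 `^ (2 - p) + n * n0 `^ (1 - p).
Proof.
move=> n_ge0 n0_gt0; have [->|nN0] := eqVneq n 0.
  by rewrite !mul0r addr0 powR_ge0.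
have n_gt0 : 0 < n by rewrite lt0r nN0.
have [le|lt] := leP n n0.
  have -> : n * n `^ (1 - p) = n `^ (2 - p).
    rewrite -[X in X * _]powRr1// -powRD ?nN0 ?implybT//; congr (_ `^ _); ring.
  rewrite ler_wpDr ?mulr_ge0 ?powR_ge0//.
  by rewrite ge0_ler_powR ?nnegrE ?subr_ge0// ltW.
rewrite ler_wpDl ?powR_ge0// ler_wpM2l//.
have -> : 1 - p = - (p - 1) by ring.
rewrite !powRN lef_pV2 ?posrE ?powR_gt0//.
by rewrite ge0_ler_powR ?nnegrE ?subr_ge0 ?(ltW p1)// ltW.
Qed.

(** With [q] the power of [n0] in [s ^+ 2], [V] the total length and [A] the sum of [fp], the energy
    estimate split at [n0] gives [24 * q * V <= 6 * n0 * q * A + 12 * q * V]; the factor 24 lets the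
    last term be absorbed. *)
Lemma size_select P (s n0 : R) : saturated P -> P \subset good_tiles -> 0 < s -> 0 < n0 ->
  s ^+ 2 = 24 * n0 `^ (1 - p) -> exists L : seq tile,
  size_le (P :\: beneath L) s /\
  \sum_(T <- L) vol (scale T) <= n0 / 2 * \sum_x fp x.
Proof.
move=> satP goodP s0 n0_gt0 sE; have [L [sL hL oL]] := size_trees f s satP.
have sat b : b \in L -> saturated b.2 by case/hL.
have gd b : b \in L -> b.2 \subset good_tiles.
  by case/hL => _ _ bP; exact: subset_trans goodP.
exists [seq b.1 | b <- L]; split => //; rewrite big_map.
have := energy_le p1 p2 root_le1 sat gd oL.
have := sum_fp_multiplicity root_le1 L.
set V := \sum_(b <- L) vol _; set S := \sum_(b <- L) _.
have VS : s ^+ 2 * V <= S.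
  rewrite /V mulr_sumr /S !big_seq; apply: ler_sum => b /hL[+ _ _]; exact: ltW.
set A := \sum_x fp x; set mu := multiplicity _ _ _ => FM SM.
have : \sum_x fp x * ((mu x)%:R * (mu x)%:R `^ (1 - p)) <=
       n0 `^ (2 - p) * A + n0 `^ (1 - p) * \sum_x fp x * (mu x)%:R.
  rewrite !mulr_sumr -big_split; apply: ler_sum => x _ /=.
  have -> : n0 `^ (2 - p) * fp x + n0 `^ (1 - p) * (fp x * (mu x)%:R) =
    fp x * (n0 `^ (2 - p) + (mu x)%:R * n0 `^ (1 - p)) by ring.
  by rewrite ler_wpM2l ?fp_ge0// powR_split.
have -> : n0 `^ (2 - p) = n0 * n0 `^ (1 - p).
  rewrite -[X in X * _]powRr1 ?(ltW n0_gt0)// -powRD ?(gt_eqF n0_gt0) ?implybT//.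
  by congr (_ `^ _); ring.
have q0 : 0 < n0 `^ (1 - p) by exact: powR_gt0.
move: SM VS; rewrite sE; move: (n0 `^ (1 - p)) q0 => q q0 SM VS.
move: (\sum_x _ * _) FM SM => B FM; move: (\sum_x _ * (_ * _)) => D SM DB.
have qB : q * B <= q * (2 * V) by rewrite ler_wpM2l// ltW.
rewrite -(ler_pM2l q0).
have -> : q * (n0 / 2 * A) = n0 * q * A / 2 by ring.
have : 24 * q * V = 24 * (q * V) by ring.
have : q * (2 * V) = 2 * (q * V) by ring.
lra.
Qed.

(** * Alternating selection by mass and by size *)

Section Iteration.
Variables (E : {set X}) (N : X -> X) (h : X -> R).
Hypothesis h_le : forall x, `|h x| <= (x \in E)%:R.
Notation mass_le := (@mass_le R M E N).
Notation form := (@form R M f N h).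

(* At step [j] of the decomposition the size is at most [sqrt 24 * ratio ^ j] and the mass at
   most [2 ^ - j]; this choice makes both families of selected trees have total length
   O(2 ^ j). *)
Definition ratio : R := 2 `^ ((1 - p) / 2).

Lemma ratio_gt0 : 0 < ratio.
Proof. exact: powR_gt0. Qed.

Lemma ratio_sqr : ratio ^+ 2 = 2 `^ (1 - p).
Proof. by rewrite /ratio -powR_mulrn ?powR_ge0// -powRrM; congr (_ `^ _); field. Qed.

(** Tops are removed first by mass, then by size with [n0 = 2 ^+ j.+1]. Both total lengths carry a
    factor [2 ^+ j.+1], which the mass [(2 ^+ j)^-1] in the tree bound cancels up to 2. *)
Lemma form_step P (j : nat) : saturated P -> P \subset good_tiles ->
  size_le P (Num.sqrt 24 * ratio ^+ j) -> mass_le P ((2 ^+ j)^-1) -> exists P',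
  [/\ saturated P', P' \subset good_tiles,
      size_le P' (Num.sqrt 24 * ratio ^+ j.+1), mass_le P' ((2 ^+ j.+1)^-1) &
      `|form P| <= `|form P'| +
         10 * Num.sqrt 24 * (2 * #|E|%:R + \sum_x fp x) * ratio ^+ j].
Proof.
move=> satP gP sP mP; set s := Num.sqrt 24 * _ in sP *; set mu := (2 ^+ j)^-1 in mP *.
have r0 := ratio_gt0.
have s0 : 0 <= s by rewrite mulr_ge0 ?sqrtr_ge0 ?exprn_ge0 ?(ltW r0).
have mu0 : 0 <= mu by rewrite invr_ge0 exprn_ge0.
have mu1 : 0 <= (2 ^+ j.+1)^-1 :> R by rewrite invr_ge0 exprn_ge0.
have [L1 [mL1 vL1]] := mass_select E N P mu1.
have satP1 := saturatedD satP (saturated_beneath L1).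
have gP1 := subset_trans (subsetDl P (beneath L1)) gP.
have s1 : 0 < Num.sqrt 24 * ratio ^+ j.+1 by rewrite mulr_gt0 ?sqrtr_gt0 ?exprn_gt0.
have [||L2 [sL2 vL2]] := @size_select _ _ (2 ^+ j.+1) satP1 gP1 s1.
- by rewrite exprn_gt0.
- rewrite exprMn sqr_sqrtr// exprAC ratio_sqr.
  rewrite -(powR_mulrn j.+1 (powR_ge0 2 (1 - p))) -powRrM.
  by rewrite [_ * j.+1%:R]mulrC powRrM powR_mulrn.
exists (P :\: beneath L1 :\: beneath L2); split => //.
- exact: saturatedD (saturated_beneath L2).
- exact: subset_trans (subsetDl _ _) gP1.
- exact: mass_leS (subsetDl _ _) mL1.
apply: le_trans (forest_bound h_le L1 satP sP mP s0 mu0) _.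
have sP1 := size_leS (subsetDl P (beneath L1)) sP.
have mP1 := mass_leS (subsetDl P (beneath L1)) mP.
apply: le_trans (lerD (forest_bound h_le L2 satP1 sP1 mP1 s0 mu0) (lexx _)) _.
rewrite -addrA lerD2l -mulrDr.
have -> : 10 * Num.sqrt 24 * (2 * #|E|%:R + \sum_x fp x) * ratio ^+ j =
  10 * s * mu * (2 ^+ j.+1 / 2 * \sum_x fp x + 2 ^+ j.+1 * #|E|%:R).
  by rewrite /s /mu exprS; field; rewrite expf_neq0 ?pnatr_eq0.
apply: ler_wpM2l; first exact: mulr_ge0 (mulr_ge0 (ler0n _ _) s0) mu0.
apply: lerD => //.
by rewrite -ler_pdivrMl ?exprn_gt0.
Qed.

Lemma form_iterate (J : nat) : exists P',
  [/\ saturated P', P' \subset good_tiles,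
      size_le P' (Num.sqrt 24 * ratio ^+ J), mass_le P' ((2 ^+ J)^-1) &
      `|form good_tiles| <= `|form P'| +
         10 * Num.sqrt 24 * (2 * #|E|%:R + \sum_x fp x) * \sum_(j < J) ratio ^+ j].
Proof.
elim: J => [|J [P [satP gP sP mP bP]]].
  exists good_tiles; split => //.
  - exact: saturated_good.
  - by rewrite expr0 mulr1; apply: size_good => //; exact: saturated_good.
  - move=> T U _ _; rewrite expr0 invr1 mul1r -(@sum_lo R M _ (loc T)).
    rewrite /density [leLHS]big_mkcond [leRHS]big_mkcond; apply: ler_sum => x _ /=.
    by rewrite /inside; case: (lo _ _ _) => //=; case: ifP.
  by rewrite big_ord0 mulr0 addr0.
have [P' [? ? ? ? bP']] := form_step satP gP sP mP; exists P'; split => //.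
rewrite big_ord_recr /= mulrDr addrA; apply: le_trans bP _.
by rewrite [leRHS]addrAC lerD2r.
Qed.

Lemma form_good : ratio < 1 ->
  `|form good_tiles| <= 10 * Num.sqrt 24 * (2 * #|E|%:R + \sum_x fp x) / (1 - ratio).
Proof.
move=> r1; have [P [satP _ _ mP bP]] := form_iterate M.+1.
apply: le_trans bP _.
(* A tile used at a point [x] of [E] has density at least 1, as [x] itself counts, whereas the mass
   bound [(2 ^+ M.+1)^-1] forces density below 1. *)
have -> : form P = 0.
  apply: big1 => x _; have [xE|xE] := boolP (x \in E); last first.
    by have := h_le x; rewrite (negbTE xE) normr_le0 => /eqP ->; rewrite mul0r.
  rewrite /packet_sum big_pred0 ?mulr0// => k; apply/negP => /andP[_ kP].
  have := mP (k, x, N x) _ kP; rewrite /below /inside lo_refl hi_refl leqnn => /(_ isT).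
  rewrite leNgt => /negP; apply.
  apply: (@lt_le_trans _ _ 1).
    rewrite -ltr_pdivlMl ?invr_gt0 ?exprn_gt0// invrK mulr1 /vol ltr_eXn2l ?ltr1n//.
    by rewrite ltnS leq_subr.
  rewrite /density (bigD1 x) /=; last by rewrite /inside lo_refl xE hi_refl.
  by rewrite lerDl sumr_ge0.
rewrite normr0 add0r; apply: ler_wpM2l.
  by rewrite !mulr_ge0 ?addr_ge0 ?mulr_ge0 ?sqrtr_ge0// sumr_ge0// => x _; exact: fp_ge0.
have r0 := ratio_gt0.
rewrite -[leRHS]mul1r ler_pdivlMr ?subr_gt0// mulrC.
have -> : (1 - ratio) * \sum_(j < M.+1) ratio ^+ j = 1 - ratio ^+ M.+1.
  by have := subrX1 ratio M.+1; lra.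
by rewrite gerBl exprn_ge0// ltW.
Qed.

End Iteration.
End Decomposition.

Section FiniteWeakType.
Variables (R : realType) (M : nat).
Notation X := {ffun 'I_M -> bool}.
Notation chr := (@chr R M).
Notation rad := (@rad R M).
Notation vol := (@vol R M).
Notation tile := (tile M).
Implicit Types (x y z m n xi : X) (k l : nat) (i j : 'I_M) (f g a : X -> R).
Implicit Types (P Q : {set tile}) (T U : tile).
Variables (f : X -> R) (p : R).
Hypotheses (p1 : 1 < p) (p2 : p <= 2).
Notation fp := (@fp R M f p).
Notation good := (@good R M f p).
Notation stop := (@stop R M f p).
Notation good_tiles := (@good_tiles R M f p).
Notation ratio := (ratio p).
(* The Walsh partial sum of order [n], by [partial_sum_carleson] below. *)
Definition carleson n x : R := \sum_(k < M | n k) chr n x * rad k x * coef f k n x.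

(** This is the weak-type (1, 1) bound for the dyadic maximal function: the stopping intervals with
    average above 1 are disjoint and cover the exceptional set. *)
Lemma card_exceptional : (#|[set x | ~~ good M x]|)%:R <= \sum_x fp x.
Proof.
pose a x : R := if 1 < avg (stop x) fp x then 1 else 0.
apply: (@le_trans _ _ (\sum_x a x * avg (stop x) fp x)).
  rewrite -sum1_card natr_sum big_mkcond; apply: ler_sum => x _ /=.
  have av0 : 0 <= avg (stop x) fp x by apply: avg_ge0; exact: fp_ge0.
  rewrite inE; case: ifP => [/negP nM|_]; last first.
    by rewrite /a; case: ifP; rewrite ?mul1r ?mul0r.
  suff av1 : 1 < avg (stop x) fp x by rewrite /a av1 mul1r ltW.
  have sM : (stop x <= M)%N by exact: first_le.
  have bad : ~~ good (stop x) x.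
    have [lt|ge] := ltnP (stop x) M.
      by have := first_true lt; rewrite -/(stop x) (minn_idPl sM).
    (* Here [M] may be the default value of [first], so badness comes from the choice of [x]. *)
    have -> : stop x = M by apply/eqP; rewrite eqn_leq sM ge.
    exact/negP.
  rewrite ltNge; apply: contra bad => av1; apply/goodP => // l.
  rewrite leq_eqVlt => /orP[/eqP -> //|ls].
  have : ~~ ~~ good (minn l M) x by exact: (@first_false _ (fun k x => ~~ good (minn k M) x)).
  have lM := leq_trans (ltnW ls) sM.
  by rewrite negbK (minn_idPl lM) => /(goodP _ _ _ lM); exact.
rewrite (@sum_avg_stopping _ _ stop a fp (@stop_stopping _ _ _ _)); last first.
  move=> x y xy; rewrite /a -(@stop_stopping _ _ _ _ _ _ xy).
  by rewrite (avg_lo _ xy).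
apply: ler_sum => x _; rewrite /a; case: ifP; rewrite ?mul1r ?mul0r// => _.
exact: fp_ge0.
Qed.

(** [ratio] is the exponential of [- ((p - 1) / 2 * ln 2)]; the bound combines [ln 2 >= 1 / 2] with
    [expR s >= 1 + s] at [s = (p - 1) / 4 <= 1]. *)
Lemma ratio_le : (p - 1) / 8 <= 1 - ratio.
Proof.
have p_gt1 := p1; have p_le2 := p2.
have e2 : expR 2^-1 <= 2 :> R.
  have h : 2^-1 <= expR (- 2^-1) :> R.
    by apply: le_trans (expR_ge1Dx _); lra.
  by rewrite -lef_pV2 ?posrE ?expR_gt0// -expRN.
have ln2 : 2^-1 <= ln 2 :> R by rewrite -ler_expR lnK ?posrE.
have powE (a : R) : 2 `^ a = expR (a * ln 2) by rewrite /powR pnatr_eq0.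
have -> : ratio = expR (- ((p - 1) / 2 * ln 2)).
  by rewrite [LHS]powE; congr expR; field.
have s0 : (p - 1) / 4 <= (p - 1) / 2 * ln 2.
  have -> : (p - 1) / 4 = (p - 1) / 2 * 2^-1 by field.
  by apply: ler_wpM2l => //; lra.
apply: (@le_trans _ _ (1 - expR (- ((p - 1) / 4)))); last first.
  by rewrite lerD2l lerN2 ler_expR lerN2.
rewrite expRN; set s := (p - 1) / 4 in s0 *.
have -> : (p - 1) / 8 = s / 2 by rewrite /s; field.
have s_gt0 : 0 < s by rewrite /s; lra.
have s_le : s <= 1 by rewrite /s; lra.
have h := @expR_ge1Dx R s.
have h2 : (expR s)^-1 <= (1 + s)^-1 by rewrite lef_pV2 ?posrE ?expR_gt0//; lra.
apply: le_trans (_ : 1 - (1 + s)^-1 <= _); last by rewrite lerD2l lerN2.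
have -> : 1 - (1 + s)^-1 = s / (1 + s) by field; lra.
by rewrite ler_pM2l// lef_pV2 ?posrE//; lra.
Qed.

(** A frequency [N x] and a sign [h x] linearize the maximal operator, so the form dominates
    [K * #|E|]. If [#|E|] exceeded the sum of [fp], this would contradict [form_good]. *)
Lemma card_carleson_good (root_le1 : forall x, avg 0 fp x <= 1) :
  (#|[set x | good M x && [exists n, 1200 / (p - 1) < `|carleson n x|]]|)%:R
    <= \sum_x fp x.
Proof.
have p_gt1 := p1; set K := 1200 / (p - 1); set E := [set x | _]; set A := \sum_x fp x.
rewrite leNgt; apply/negP => AE.
have A0 : 0 <= A by apply: sumr_ge0 => x _; exact: fp_ge0.
pose N x := odflt x [pick n | K < `|carleson n x|].
pose h x : R := if x \in E then Num.sg (carleson (N x) x) else 0.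
have NP x : x \in E -> K < `|carleson (N x) x|.
  rewrite inE /N => /andP[_ /existsP[n Kn]]; case: pickP => //= /(_ n).
  by rewrite Kn.
have h_le x : `|h x| <= (x \in E)%:R.
  by rewrite /h; case: ifP => _; rewrite ?normr0// normr_sg lern1 leq_b1.
have r8 := ratio_le; have r1 : ratio < 1 by lra.
have := form_good p1 p2 root_le1 N h_le r1; rewrite -/A; set B := form _ _ _ _ => BE.
have : K * #|E|%:R <= `|B|.
  rewrite -sum1_card natr_sum mulr_sumr; apply: le_trans (ler_norm _).
  rewrite /B /form big_mkcond; apply: ler_sum => x _ /=.
  rewrite /h; case: ifP => [xE|]; last by rewrite mul0r.
  (* All intervals around a good point are good, so the restriction to [good_tiles] loses nothing
     there. *)
  have -> : packet_sum f N good_tiles x = carleson (N x) x.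
    rewrite /packet_sum; apply: eq_bigl => k; rewrite inE /scale /loc /=.
    move: (xE); rewrite inE => /andP[/(goodP _ _ _ (leqnn M)) gM _].
    rewrite andb_idr// => _; apply/goodP => [|l lk]; first exact: ltnW.
    by apply: gM; exact: leq_trans lk (ltnW _).
  by rewrite mulr1 -normrEsg ltW// NP.
have E0 : 0 < #|E|%:R :> R by exact: le_lt_trans AE.
have c0 := sqrtr_ge0 (24 : R).
have c5 : Num.sqrt 24 < 5 :> R.
  by rewrite -ltr_sqr ?nnegrE// sqr_sqrtr//; lra.
move: BE; rewrite ler_pdivlMr; last by lra.
move: (`|B|) (#|E|%:R) AE E0 => b e AE E0 BE Kb.
have p10 : 0 < p - 1 by lra.
have : K * e * ((p - 1) / 8) <= b * (1 - ratio).
  apply: ler_pM => //; last by rewrite divr_ge0// ltW.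
  by apply: mulr_ge0; [rewrite divr_ge0// ltW|exact: ltW].
(* The constant 1200 is [8 * 10 * 5 * 3]: 8 from [ratio_le], 10 from the tree bound, 5 above the
   root of 24, and 3 from [2 * e + A < 3 * e]. *)
have -> : K * e * ((p - 1) / 8) = 150 * e by rewrite /K; field; rewrite gt_eqF.
have : 10 * Num.sqrt 24 * (2 * e + A) < 10 * 5 * (3 * e).
  by apply: ltr_pM; rewrite ?mulr_ge0 ?addr_ge0 ?mulr_ge0// ?(ltW E0)//; lra.
lra.
Qed.

(* If the mean of [|f| ^ p] exceeds 1, the bound is weaker than the number of points. *)
Lemma card_carleson :
  (#|[set x | [exists n, 1200 / (p - 1) < `|carleson n x|]]|)%:R
    <= 2 * \sum_x fp x.
Proof.
have A0 : 0 <= \sum_x fp x by apply: sumr_ge0 => x _; exact: fp_ge0.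
have [root|] := leP (\sum_x fp x) (vol 0).
  have root1 x : avg 0 fp x <= 1.
    rewrite /avg mulrC ler_pdivrMr ?vol_gt0// mul1r; apply: le_trans root.
    by rewrite big_mkcond; apply: ler_sum => y _; case: ifP => // _; exact: fp_ge0.
  have := card_carleson_good root1; have := card_exceptional.
  set E1 := [set x | _]; set E2 := [set x | _ && _]; set E := [set x | _].
  have : (#|E| <= #|E1| + #|E2|)%N.
    apply: leq_trans (leq_card_setU E1 E2); apply: subset_leq_card.
    apply/subsetP => x; rewrite !inE => ->; by case: (good M x).
  rewrite -(ler_nat R) natrD; lra.
set E := [set x | _]; move=> lt; have : #|E|%:R <= vol 0.
  pose x0 : X := [ffun=> false].
  rewrite -(sum_lo R 0 x0) -sum1_card natr_sum big_mkcond [leRHS]big_mkcond.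
  apply: ler_sum => x _ /=; have -> : lo 0 x0 x by apply/loP.
  by case: ifP.
lra.
Qed.
End FiniteWeakType.

Section PartialSums.
Variables (R : realType) (M : nat).
Notation X := {ffun 'I_M -> bool}.
Notation chr := (@chr R M).
Notation rad := (@rad R M).
Notation vol := (@vol R M).
Notation tile := (tile M).
Implicit Types (x y z m n xi : X) (k l : nat) (i j : 'I_M) (f g a : X -> R).
Implicit Types (P Q : {set tile}) (T U : tile).
Notation carleson := (@carleson R M).
(** * Dirichlet kernels and partial sums *)

Lemma card_carleson_scaled f (p lam : R) : 1 < p -> p <= 2 -> 0 < lam ->
  (#|[set x | [exists n, lam < `|carleson f n x|]]|)%:R
    <= 2 * (1200 / (p - 1) / lam) `^ p * \sum_x `|f x| `^ p.
Proof.
move=> p1 p2 lam0; have p10 : 0 < p - 1 by rewrite subr_gt0.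
set K := 1200 / (p - 1); have K0 : 0 < K by rewrite divr_gt0.
set c := K / lam; have c0 : 0 < c by rewrite divr_gt0.
pose g x := c * f x.
have gE n x : carleson g n x = c * carleson f n x.
  rewrite /carleson mulr_sumr; apply: eq_bigr => k _.
  have -> : coef g k n x = c * coef f k n x.
    by rewrite /coef -avgZ; apply: avg_ext => y _; rewrite /g; ring.
  by ring.
have := @card_carleson R M g p p1 p2; rewrite -/K.
have -> : [set x | [exists n, K < `|carleson g n x|]] =
          [set x | [exists n, lam < `|carleson f n x|]].
  apply/setP => x; rewrite !inE; apply: eq_existsb => n.
  rewrite gE normrM (gtr0_norm c0) -ltr_pdivrMl// /c invf_div.
  by rewrite mulrAC mulfK ?gt_eqF// mul1r divfK ?gt_eqF.
move/le_trans; apply; rewrite -mulrA ler_pM2l// mulr_sumr; apply: ler_sum => x _.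
by rewrite /fp /g normrM (gtr0_norm c0) powRM// ltW.
Qed.

Definition nat_digit (n j : nat) := odd (n %/ 2 ^ j).
Definition nat_digits (n : nat) : X := [ffun i : 'I_M => nat_digit n i].

Lemma nat_digit_small (k l j : nat) : (k < 2 ^ l)%N -> (l <= j)%N -> nat_digit k j = false.
Proof.
move=> kl lj; rewrite /nat_digit divn_small//; apply: leq_trans kl _.
by rewrite leq_exp2l.
Qed.

Lemma nat_digits_add (l : 'I_M) (k : nat) : (k < 2 ^ l)%N ->
  nat_digits (2 ^ l + k) = flip l (nat_digits k).
Proof.
move=> kl; apply/ffunP => i; rewrite !ffunE.
have [->|il] := eqVneq i l.
  rewrite /nat_digit divnDl ?dvdnn// divnn expn_gt0 /= divn_small//.
case: (ltngtP i l) => [lt|gt|/val_inj e]; last by rewrite e eqxx in il.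
  rewrite addbF /nat_digit -(subnK (ltnW lt)) expnD divnMDl ?expn_gt0// oddD oddX.
  by rewrite subn_eq0 leqNgt lt.
rewrite addbF (nat_digit_small kl (ltnW gt)) (@nat_digit_small _ l.+1)//.
by rewrite expnS mul2n -addnn ltn_add2l.
Qed.

Lemma chrC m n : chr m n = chr n m.
Proof. by apply: eq_bigr => i _; rewrite andbC. Qed.

Lemma chr_nat_add (l : 'I_M) (k : nat) x : (k < 2 ^ l)%N ->
  chr (nat_digits (2 ^ l + k)) x = rad l x * chr (nat_digits k) x.
Proof. by move=> kl; rewrite nat_digits_add// chrC chr_flip chrC. Qed.

Definition origin : X := [ffun=> false].

Lemma chr_nat_lo (l k : nat) x : (k < 2 ^ l)%N -> lo l origin x ->
  chr (nat_digits k) x = 1.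
Proof.
move=> kl /loP x0; apply: big1 => i _; have [il|li] := ltnP i l.
  by rewrite -x0// !ffunE andbF.
by rewrite ffunE (nat_digit_small kl li).
Qed.

Lemma sum_nat_add (l n : nat) (F : nat -> R) :
  \sum_(0 <= k < l + n) F k = \sum_(0 <= k < l) F k + \sum_(0 <= k < n) F (l + k)%N.
Proof.
rewrite (@big_cat_nat _ _ _ l)//= ?leq_addr//; congr (_ + _).
by rewrite -{1}[l]add0n big_addn addKn; apply: eq_bigr => i _; rewrite addnC.
Qed.

(** Doubling the range multiplies the kernel by [1 + rad l], which is 2 or 0 according to digit [l]
    of [x]. *)
Lemma dirichlet_dyadic (l : nat) x : (l <= M)%N ->
  \sum_(0 <= k < 2 ^ l) chr (nat_digits k) x = if lo l origin x then 2 ^+ l else 0.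
Proof.
elim: l => [|l IH] lM.
  rewrite big_nat1 expr0 (@chr_nat_lo 0)//; last by apply/loP.
  by case: ifP => // /negP; case; apply/loP.
pose i := Ordinal lM.
rewrite expnS mul2n -addnn sum_nat_add (IH (ltnW lM)).
rewrite (@eq_big_nat _ _ _ _ _ _ (fun k => rad i x * chr (nat_digits k) x)); last first.
  by move=> k /andP[_ kl]; exact: (@chr_nat_add i).
rewrite -mulr_sumr (IH (ltnW lM)).
have -> : lo l.+1 origin x = lo l origin x && ~~ x i.
  apply/loP/andP => [h|[/loP h xi] j].
    by split; [apply/loP => j jl; apply: h; exact: ltnW|rewrite -h// ffunE].
  rewrite ltnS leq_eqVlt => /orP[/eqP jl|/h//].
  by have -> : j = i by [exact: val_inj]; rewrite ffunE (negbTE xi).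
rewrite /rad; case: (lo l origin x) => /=; last by rewrite mulr0 addr0.
by case: (x i); rewrite /= ?expr0 ?expr1 ?exprS; ring.
Qed.

(** Removing the top digit [l] of [n] splits off the kernel of order [2 ^ l] and leaves [rad l]
    times a shorter kernel. Where the dyadic kernel is nonzero, the character of the remaining
    digits is 1, so the factors [chr] and [rad] may be inserted. *)
Lemma dirichlet (n : nat) x : (n < 2 ^ M)%N ->
  \sum_(0 <= k < n) chr (nat_digits k) x =
  \sum_(i < M | nat_digit n i)
     (if lo i origin x then 2 ^+ i else 0) * chr (nat_digits n) x * rad i x.
Proof.
suff H l : (l <= M)%N -> (n < 2 ^ l)%N -> \sum_(0 <= k < n) chr (nat_digits k) x =
  \sum_(i < M | nat_digit n i)
     (if lo i origin x then 2 ^+ i else 0) * chr (nat_digits n) x * rad i x by exact: H.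
elim: l n => [|l IH] n lM.
  rewrite expn0 ltnS leqn0 => /eqP ->; rewrite big_nil big_pred0// => i.
  by rewrite /nat_digit div0n.
have [nl _|ln] := ltnP n (2 ^ l); first exact: IH (ltnW lM) nl.
rewrite -(subnKC ln); move: (n - 2 ^ l)%N => k {ln n}.
rewrite expnS mul2n -addnn ltn_add2l => kl.
pose i := Ordinal lM.
rewrite sum_nat_add (dirichlet_dyadic x (ltnW lM)).
rewrite (@eq_big_nat _ _ _ _ _ _ (fun j : nat => rad i x * chr (nat_digits j) x)); last first.
  by move=> j /andP[_ jl]; apply: (@chr_nat_add i); exact: ltn_trans kl.
rewrite -mulr_sumr (IH k (ltnW lM) kl) [RHS](bigD1 i) /=; last first.
  have := nat_digits_add (kl : (k < 2 ^ i)%N) => /= /ffunP/(_ i).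
  by rewrite flip_id !ffunE /= => ->; rewrite (nat_digit_small kl).
have /= -> := chr_nat_add x (kl : (k < 2 ^ i)%N); congr (_ + _).
  case: ifP => [l0|_]; last by rewrite !mul0r.
  by rewrite (chr_nat_lo kl l0) mulr1 -mulrA rad_sqr mulr1.
rewrite mulr_sumr; apply: eq_big => j.
  have := nat_digits_add (kl : (k < 2 ^ i)%N) => /= /ffunP/(_ j); rewrite flipE !ffunE => ->.
  have [->|ji] := eqVneq j i; first by rewrite andbF (nat_digit_small kl).
  by rewrite addbF andbT.
by move=> _; ring.
Qed.

Definition xorX x y : X := [ffun i => x i (+) y i].

Lemma chr_xor n x y : chr n (xorX x y) = chr n x * chr n y.
Proof.
rewrite /chr -big_split; apply: eq_bigr => i _ /=; rewrite ffunE.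
by case: (n i) (x i) (y i) => [] [] []; rewrite /= ?expr0 ?expr1; ring.
Qed.

Lemma rad_xor i x y : rad i (xorX x y) = rad i x * rad i y.
Proof.
by rewrite /rad ffunE; case: (x i) (y i) => [] []; rewrite /= ?expr0 ?expr1; ring.
Qed.

Lemma lo_xor k x y : lo k origin (xorX x y) = lo k x y.
Proof.
apply/loP/loP => h i ik; have := h i ik; rewrite !ffunE.
  by case: (x i) (y i) => [] [].
by move->; rewrite addbb.
Qed.

(** The partial sum is a convolution with the Dirichlet kernel for the group law [xorX]; each dyadic
    kernel in it acts as an average [avg i]. *)
Lemma partial_sum_carleson f (n : nat) x : (n < 2 ^ M)%N ->
  \sum_(0 <= k < n) ((2 ^+ M)^-1 * \sum_y f y * chr (nat_digits k) y) * chr (nat_digits k) x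
  = carleson f (nat_digits n) x.
Proof.
move=> nM.
transitivity ((2 ^+ M)^-1 * \sum_y f y * \sum_(0 <= k < n) chr (nat_digits k) (xorX x y)).
  rewrite [RHS]mulr_sumr; under [RHS]eq_bigr do rewrite mulr_sumr mulr_sumr.
  rewrite [RHS]exchange_big; apply: eq_bigr => k _ /=.
  rewrite -mulrA mulr_suml mulr_sumr; apply: eq_bigr => y _.
  by rewrite chr_xor; ring.
rewrite /carleson; under eq_bigr do rewrite (dirichlet _ nM) mulr_sumr.
rewrite exchange_big mulr_sumr; apply: eq_big => i; first by rewrite ffunE.
move=> _; rewrite /coef /avg /=.
have -> : (vol i)^-1 = (2 ^+ M)^-1 * 2 ^+ i.
  rewrite /vol exprB ?(ltnW (ltn_ord i)) ?unitfE ?pnatr_eq0//.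
  by rewrite invf_div mulrC.
rewrite !mulr_sumr [RHS]big_mkcond; apply: eq_bigr => y _ /=.
rewrite lo_xor chr_xor rad_xor; case: ifP => _; last by ring.
by ring.
Qed.
End PartialSums.

From mathcomp Require Import all_classical all_reals all_analysis.
From mathcomp Require Import complex measurable_realfun.

Import numFieldNormedType.Exports.

Local Open Scope classical_set_scope.
Local Open Scope ring_scope.

(** * Dyadic intervals *)

Section Cells.
Variable R : realType.
Notation mu := (@lebesgue_measure R).
Notation torus := (@torus R).

Definition digit (j : nat) (x : R) : bool := odd `|Num.floor (2 ^+ j.+1 * x)|%N.

Definition left_end (c : nat -> bool) (M : nat) : R :=
  \sum_(j < M) (c j)%:R / 2 ^+ j.+1.

Lemma left_end_nat c M : exists a : nat, 2 ^+ M * left_end c M = a%:R.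
Proof.
elim: M => [|M [a IH]]; first by exists 0%N; rewrite /left_end big_ord0 mulr0.
exists (2 * a + c M)%N; rewrite /left_end big_ord_recr /= -/(left_end c M) mulrDr.
rewrite exprS -mulrA IH natrD natrM; congr (_ + _).
by rewrite -exprS mulrC divfK// expf_neq0// pnatr_eq0.
Qed.

Lemma torusE x : torus x <-> 0 <= x < 1.
Proof. by rewrite /Defs.torus /= in_itv. Qed.

Lemma digit_split (a : nat) (x : R) (M : nat) :
  2 * a%:R <= 2 ^+ M.+1 * x < 2 * a%:R + 2 ->
  digit M x = (2 * a%:R + 1 <= 2 ^+ M.+1 * x).
Proof.
have -> : 2 * a%:R = (2 * a)%N%:R :> R by rewrite natrM.
have -> : (2 * a)%N%:R + 1 = (2 * a + 1)%N%:R :> R by rewrite natrD.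
have -> : (2 * a)%N%:R + 2 = (2 * a + 2)%N%:R :> R by rewrite natrD.
move=> /andP[ya yb]; rewrite /digit; case: leP => y1.
  have -> : Num.floor (2 ^+ M.+1 * x) = (2 * a + 1)%N.
    by apply: floor_def; rewrite -[(_ + 1)%Z]/((2 * a + 1 + 1)%N : int) -!pmulrn y1 -addnA.
  by rewrite absz_nat oddD mul2n odd_double.
have -> : Num.floor (2 ^+ M.+1 * x) = (2 * a)%N.
  by apply: floor_def; rewrite -[(_ + 1)%Z]/((2 * a + 1)%N : int) -!pmulrn ya.
by rewrite absz_nat mul2n odd_double.
Qed.

(** Each further digit tells the left half of a dyadic interval from the right half: as
    [left_end c M] is a multiple of [2 ^ - M], [digit M] compares [x] with the midpoint. *)
Lemma digits_itv c M x :
  (torus x /\ forall j, (j < M)%N -> digit j x = c j) <->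
  left_end c M <= x < left_end c M + (2 ^+ M)^-1.
Proof.
elim: M => [|M IH].
  rewrite /left_end big_ord0 expr0 invr1 add0r -torusE.
  by split => [[]//|]; split.
transitivity ((torus x /\ forall j, (j < M)%N -> digit j x = c j) /\ digit M x = c M).
  split => [[tx h]|[[tx h] hM]].
    by split; [split=> // j jM; apply: h; exact: ltnW|apply: h].
  split=> // j; rewrite ltnS leq_eqVlt => /orP[/eqP ->//|]; exact: h.
have [a aE] := left_end_nat c M.
have p0 : 0 < 2 ^+ M :> R by rewrite exprn_gt0.
have lE : left_end c M = a%:R / 2 ^+ M by rewrite -aE mulrC mulKf ?gt_eqF.
have -> : left_end c M.+1 = left_end c M + (c M)%:R / 2 ^+ M.+1.
  by rewrite /left_end big_ord_recr.
have e2 : (2 ^+ M.+1)^-1 = (2 ^+ M)^-1 / 2 :> R.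
  by rewrite exprS invfM mulrC.
have xE : 2 ^+ M.+1 * x = 2 * (2 ^+ M * x) by rewrite exprS mulrA.
have H : left_end c M <= x < left_end c M + (2 ^+ M)^-1 ->
    digit M x = (2 * a%:R + 1 <= 2 * (2 ^+ M * x)).
  rewrite lE -[X in _ + X]mul1r -mulrDl ler_pdivrMr// ltr_pdivlMr// [x * _]mulrC => hx.
  by rewrite (@digit_split a) xE//; move: hx; lra.
rewrite e2; set u := left_end c M in lE H IH *; set v := (2 ^+ M)^-1 in H IH *.
have v0 : 0 < v by rewrite invr_gt0.
have xv : (2 * a%:R + 1 <= 2 * (2 ^+ M * x)) = (u + v / 2 <= x).
  have -> : u + v / 2 = (2 * a%:R + 1) / (2 * 2 ^+ M) by rewrite lE /v; field; rewrite gt_eqF.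
  by rewrite ler_pdivrMr ?mulr_gt0//; congr (_ <= _); ring.
rewrite xv in H.
split => [[/IH hx dM]|].
  have := H hx; rewrite dM; case: (c M) => /esym e; rewrite ?mul1r ?mul0r.
    have {}e : u + v / 2 <= x by rewrite e.
    by lra.
  by move/negbT: e; rewrite -ltNge => e; lra.
move=> hx; have hx' : u <= x < u + v.
  by move: hx; case: (c M); rewrite ?mul1r ?mul0r /=; lra.
split; first exact/IH; rewrite (H hx'); apply/idP/idP.
  by move: hx; case: (c M) => //; rewrite mul0r addr0 => /andP[_ h1] h2; lra.
by move=> cM; move: hx; rewrite cM mul1r; lra.
Qed.

Variable M : nat.
Notation X := {ffun 'I_M -> bool}.

Definition digits (x : R) : X := [ffun i : 'I_M => digit i x].
Definition cell (b : X) : set R := [set x | torus x /\ digits x = b].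

Let ext (b : X) (j : nat) : bool := oapp b false (insub j).

Let extE (b : X) (i : 'I_M) : ext b i = b i.
Proof. by rewrite /ext valK. Qed.

Lemma cell_itv b :
  cell b = `[left_end (ext b) M, left_end (ext b) M + (2 ^+ M)^-1[%classic.
Proof.
apply/seteqP; split => x /=; rewrite in_itv /=.
  move=> [tx <-]; apply/digits_itv; split => // j jM.
  by rewrite (extE _ (Ordinal jM)) ffunE.
move=> /digits_itv[tx h]; split=> //; apply/ffunP => i.
by rewrite ffunE h// extE.
Qed.

Lemma measurable_cell b : measurable (cell b).
Proof. by rewrite cell_itv; exact: measurable_itv. Qed.

Lemma measure_cell b : mu (cell b) = ((2 ^+ M)^-1)%:E.
Proof.
rewrite cell_itv lebesgue_measure_itv /= lte_fin ltrDl invr_gt0 exprn_gt0//.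
by rewrite -EFinB addrAC subrr add0r.
Qed.

Lemma trivIset_cell (D : set X) : trivIset D cell.
Proof. by move=> b c _ _ [x [[_ <-] [_ <-]]]. Qed.

Lemma bigcup_cell (Q : pred X) :
  [set x | torus x /\ Q (digits x)] = \big[setU/set0]_(b <- [seq b <- enum X | Q b]) cell b.
Proof.
rewrite -bigcup_seq; apply/seteqP; split => x /=.
  by move=> [tx Qx]; exists (digits x) => //=; rewrite mem_filter Qx mem_enum.
by move=> [b /=]; rewrite mem_filter => /andP[Qb _] [tx xb]; rewrite xb.
Qed.

Lemma torus_cells : torus = \big[setU/set0]_(b <- enum X) cell b.
Proof.
have := bigcup_cell xpredT; rewrite filter_predT => <-.
by apply/seteqP; split => x /=; [split|case].
Qed.

Lemma measurable_digits (Q : pred X) : measurable [set x | torus x /\ Q (digits x)].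
Proof.
by rewrite bigcup_cell; apply: bigsetU_measurable => b _; exact: measurable_cell.
Qed.

Lemma measure_digits (Q : pred X) :
  mu [set x | torus x /\ Q (digits x)] = (#|Q|%:R / 2 ^+ M)%:E.
Proof.
rewrite -[LHS]mul1e -integral_cst; last exact: measurable_digits.
rewrite bigcup_cell ge0_integral_bigsetU//; last first.
- exact: trivIset_cell.
- by rewrite filter_uniq// enum_uniq.
- exact: measurable_cell.
rewrite (eq_bigr (fun=> ((2 ^+ M)^-1)%:E)) => [|b _]; last first.
  by rewrite integral_cst; [rewrite mul1e; exact: measure_cell|exact: measurable_cell].
rewrite sumEFin big_filter big_enum_cond /= sumr_const mulr_natl; reflexivity.
Qed.

End Cells.

(** * Walsh coefficients through cell averages *)

Section CellAverages.
Variables (R : realType) (M : nat).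
Notation X := {ffun 'I_M -> bool}.
Notation mu := (@lebesgue_measure R).
Notation torus := (@torus R).
Notation chr := (@chr R M).
Notation cell := (@cell R M).
Notation digits := (@digits R M).
Notation nat_digits := (@nat_digits M).

Lemma rademacher_digit (j : nat) (x : R) : 0 <= x ->
  rademacher j x = (-1) ^+ digit j x.
Proof.
move=> x0; rewrite /rademacher /digit.
have : 0 <= Num.floor (2 ^+ j.+1 * x) by rewrite floor_ge0 mulr_ge0 ?exprn_ge0.
by case: (Num.floor _) => // m _; rewrite absz_nat signr_odd.
Qed.

(** [walsh] multiplies over [j < n] and [chr] over [j < M]; the factors beyond either range are
    1. *)
Lemma eq_prod_ord (a b : nat) (F : nat -> R) :
  (forall j, (a <= j)%N -> F j = 1) -> (forall j, (b <= j)%N -> F j = 1) ->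
  \prod_(j < a) F j = \prod_(j < b) F j.
Proof.
wlog ab : a b / (a <= b)%N.
  by move=> H ha hb; case/orP: (leq_total a b) => h; [|symmetry]; apply: H.
move=> ha _; rewrite (big_ord_widen b F ab) big_mkcond; apply: eq_bigr => j _.
by case: ltnP => // /ha.
Qed.

Lemma walsh_chr (n : nat) (x : R) : torus x -> (n < 2 ^ M)%N ->
  walsh n x = chr (nat_digits n) (digits x).
Proof.
move=> /torusE/andP[x0 _] nM.
pose F j : R := (-1) ^+ (nat_digit n j && digit j x).
have -> : chr (nat_digits n) (digits x) = \prod_(j < M) F j.
  by apply: eq_bigr => j _; rewrite !ffunE.
rewrite -(@eq_prod_ord n) /F => [|j nj|j Mj]; last 2 first.
- by rewrite (@nat_digit_small n n)// ltn_expl.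
- by rewrite (nat_digit_small nM).
apply: eq_bigr => j _; rewrite rademacher_digit//.
rewrite /binary_digit /nat_digit modn2.
by case: (odd _); rewrite /= ?expr0 ?expr1.
Qed.

Lemma measurable_torus : measurable torus.
Proof. exact: measurable_itv. Qed.

Lemma measurable_walsh (n : nat) : (n < 2 ^ M)%N -> measurable_fun torus (@walsh R n).
Proof.
move=> nM _ Y mY.
have -> : torus `&` walsh n @^-1` Y =
    [set x | torus x /\ `[< Y (chr (nat_digits n) (digits x)) >]].
  apply/seteqP; split => x [tx Yx]; split=> //.
    by apply/asboolP; rewrite -walsh_chr.
  by rewrite /preimage /= walsh_chr//; exact/asboolP.
exact: (@measurable_digits R M (fun b => `[< Y (chr (nat_digits n) b) >])).
Qed.

Lemma Rintegral_cells (g : R -> R) : mu.-integrable torus (EFin \o g) ->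
  \int[mu]_(x in torus) g x = \sum_b \int[mu]_(x in cell b) g x.
Proof.
move=> gi; rewrite /Rintegral (torus_cells R M) integral_bigsetU_EFin.
- rewrite big_enum /= [RHS]sum_fine// => b _.
  apply: integrable_fin_num; first exact: measurable_cell.
  apply: integrableS gi; [exact: measurable_torus|exact: measurable_cell|].
  by move=> x [].
- exact: measurable_cell.
- exact: enum_uniq.
- exact: trivIset_cell.
- by rewrite -torus_cells; exact: measurable_int gi.
Qed.

Definition cell_avg (g : R -> R) (b : X) : R := 2 ^+ M * \int[mu]_(x in cell b) g x.

Section Integrable.
Variable g : R -> R.
Hypothesis gi : mu.-integrable torus (EFin \o g).

Lemma integrable_cell (h : R -> R) (b : X) : mu.-integrable torus (EFin \o h) ->
  mu.-integrable (cell b) (EFin \o h).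
Proof.
by apply: integrableS; [exact: measurable_torus|exact: measurable_cell|move=> x []].
Qed.

Lemma integral_walsh (k : nat) : (k < 2 ^ M)%N ->
  \int[mu]_(x in torus) (g x * walsh k x) =
  (2 ^+ M)^-1 * \sum_b cell_avg g b * chr (nat_digits k) b.
Proof.
move=> kM; rewrite Rintegral_cells.
  rewrite mulr_sumr; apply: eq_bigr => b _.
  transitivity (\int[mu]_(x in cell b) (g x * chr (nat_digits k) b)).
    by apply: eq_Rintegral => x /[!inE] -[tx <-]; rewrite walsh_chr.
  rewrite RintegralZr; [|exact: measurable_cell|exact: integrable_cell].
  by rewrite /cell_avg -mulrA mulKf// expf_neq0// pnatr_eq0.
have mg : measurable_fun torus g by apply/measurable_EFinP; exact: measurable_int gi.
apply: (le_integrable _ _ _ gi); first exact: measurable_torus.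
  by apply/measurable_EFinP; apply: measurable_funM => //; exact: measurable_walsh.
move=> x tx /=; rewrite lee_fin normrM walsh_chr//.
by rewrite [`|chr _ _|]normr_chr mulr1.
Qed.

Lemma partial_sum_cell_avg (n : nat) (x : R) : torus x -> (n < 2 ^ M)%N ->
  \sum_(k < n) (\int[mu]_(y in torus) (g y * walsh k y)) * walsh k x =
  carleson (cell_avg g) (nat_digits n) (digits x).
Proof.
move=> tx nM; rewrite -partial_sum_carleson// big_mkord; apply: eq_bigr => k _.
have kM := ltn_trans (ltn_ord k) nM.
by rewrite walsh_chr// integral_walsh.
Qed.

Variable p : R.
Hypothesis p1 : 1 < p.
Hypothesis gp : mu.-integrable torus (fun x => (`|g x| `^ p)%:E).

(** Jensen's inequality: Young's inequality for [|g x|] and the power [p - 1] of [c] is integrated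
    over the cell, and the term in [c] is absorbed. *)
Lemma cell_avg_powR (b : X) :
  `|cell_avg g b| `^ p <= 2 ^+ M * \int[mu]_(x in cell b) (`|g x| `^ p).
Proof.
have p_gt1 := p1; have p0 : 0 < p by lra.
set c := `|cell_avg g b|; set I := \int[mu]_(x in _) _.
have mc := measurable_cell (b : X) : measurable (cell b).
have gic := integrable_cell b gi; have gpc := integrable_cell b gp.
have P0 : 0 < 2 ^+ M :> R by rewrite exprn_gt0.
pose q := p / (p - 1).
have q0 : 0 < q by rewrite divr_gt0// subr_gt0.
have pq : p^-1 + q^-1 = 1 by rewrite /q; field; rewrite !gt_eqF//; lra.
have cI : c <= 2 ^+ M * \int[mu]_(x in cell b) `|g x|.
  rewrite /c /cell_avg normrM gtr0_norm// ler_pM2l//.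
  exact: le_normr_Rintegral.
have cq : (c `^ (p - 1)) `^ q = c `^ p.
  by rewrite -powRrM; congr (_ `^ _); rewrite /q; field; rewrite gt_eqF//; lra.
have ci1 (r : R) : mu.-integrable (cell b) (EFin \o (fun=> r)).
  apply: measurable_bounded_integrable => //.
    by apply: (@le_lt_trans _ _ ((2 ^+ M)^-1)%:E); rewrite ?ltry// -(measure_cell R b).
  by exists `|r|; split => // s rs x _; exact: ltW.
have gic' : mu.-integrable (cell b) (EFin \o (fun x => `|g x|)) by exact: integrable_norm gic.
have iZ (k : R) (h : R -> R) : mu.-integrable (cell b) (EFin \o h) ->
    mu.-integrable (cell b) (EFin \o (fun x => k * h x)).
  move=> hi; have := @integrableZl _ _ _ mu _ mc k _ hi.
  by apply: eq_integrable => // x _; rewrite /= EFinM.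
have iD (h1 h2 : R -> R) : mu.-integrable (cell b) (EFin \o h1) ->
    mu.-integrable (cell b) (EFin \o h2) ->
    mu.-integrable (cell b) (EFin \o (fun x => h1 x + h2 x)).
  move=> h1i h2i; have := @integrableD _ _ _ mu _ mc _ _ h1i h2i.
  by apply: eq_integrable => // x _; rewrite /= EFinD.
have : \int[mu]_(x in cell b) (c `^ (p - 1) * `|g x|) <=
       \int[mu]_(x in cell b) (p^-1 * `|g x| `^ p + c `^ p / q).
  apply: le_Rintegral => //.
  - exact: iZ.
  - by apply: iD; [exact: iZ|exact: ci1].
  move=> x _; have := conjugate_powR (normr_ge0 (g x)) (powR_ge0 c (p - 1)) p0 q0 pq.
  by rewrite cq mulrC [p^-1 * _]mulrC.
rewrite RintegralZl// RintegralD//; last exact: iZ.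
rewrite Rintegral_cst// RintegralZl//.
have -> : fine (mu (cell b)) = (2 ^+ M)^-1.
  by rewrite -[RHS]/(fine ((2 ^+ M)^-1)%:E) -(measure_cell R b).
rewrite -/I => H.
have ccp : c * c `^ (p - 1) = c `^ p.
  have [->|c0] := eqVneq c 0; first by rewrite mul0r powR0// gt_eqF.
  have c_ge0 : 0 <= c by exact: normr_ge0.
  transitivity (c `^ 1 * c `^ (p - 1)); first by rewrite powRr1.
  by rewrite -powRD ?c0 ?implybT//; congr (_ `^ _); ring.
have : c `^ (p - 1) * c <= c `^ (p - 1) * (2 ^+ M * \int[mu]_(x in cell b) `|g x|).
  by rewrite ler_wpM2l ?powR_ge0.
rewrite [c `^ _ * c]mulrC ccp mulrCA => H1.
have {}H1 := le_trans H1 (ler_wpM2l (ltW P0) H).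
have qE : q^-1 = 1 - p^-1 by rewrite -pq addrAC subrr add0r.
have E : 2 ^+ M * (p^-1 * I + c `^ p / q / 2 ^+ M) = 2 ^+ M * I / p + c `^ p * (1 - p^-1).
  by rewrite -qE; field; rewrite !gt_eqF.
rewrite E in H1.
have {}H1 : c `^ p / p <= 2 ^+ M * I / p by lra.
by move: H1; rewrite ler_pM2r// invr_gt0.
Qed.

Lemma sum_cell_avg_powR :
  (2 ^+ M)^-1 * \sum_b `|cell_avg g b| `^ p <= \int[mu]_(x in torus) (`|g x| `^ p).
Proof.
rewrite ler_pdivrMl ?exprn_gt0// (Rintegral_cells gp) mulr_sumr.
by apply: ler_sum => b _; exact: cell_avg_powR.
Qed.

End Integrable.
End CellAverages.

(** * The weak-type bound on the torus *)

Section Torus.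
Variable R : realType.
Notation mu := (@lebesgue_measure R).
Notation torus := (@torus R).
Implicit Types (f : R -> R[i]) (p lam : R).

Lemma normc_complex (a b : R) : Normc.normc (Complex a b) = Num.sqrt (a ^+ 2 + b ^+ 2).
Proof. by []. Qed.

Lemma normc_ge0 (z : R[i]) : 0 <= Normc.normc z.
Proof. by case: z => a b; exact: sqrtr_ge0. Qed.

Lemma normc_le (a b : R) : Normc.normc (Complex a b) <= `|a| + `|b|.
Proof.
rewrite normc_complex -[leRHS]ger0_norm ?addr_ge0// -sqrtr_sqr ler_wsqrtr//.
rewrite sqrrD !real_normK ?num_real// [leRHS]addrAC lerDl.
by rewrite mulrn_wge0// mulr_ge0.
Qed.

Lemma normc_ge_Re (z : R[i]) : `|complex.Re z| <= Normc.normc z.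
Proof.
by case: z => a b; rewrite normc_complex -sqrtr_sqr ler_wsqrtr// lerDl sqr_ge0.
Qed.

Lemma normc_ge_Im (z : R[i]) : `|complex.Im z| <= Normc.normc z.
Proof.
by case: z => a b; rewrite normc_complex -sqrtr_sqr ler_wsqrtr// lerDr sqr_ge0.
Qed.

Lemma walsh_partial_sumE (n : nat) f x : walsh_partial_sum n f x =
  Complex
    (\sum_(k < n) (\int[mu]_(y in torus) (complex.Re (f y) * walsh k y)) * walsh k x)
    (\sum_(k < n) (\int[mu]_(y in torus) (complex.Im (f y) * walsh k y)) * walsh k x).
Proof.
rewrite /walsh_partial_sum; elim: n => [|n IH]; first by rewrite !big_ord0.
rewrite !big_ord_recr /= IH /walsh_coef; apply/eqP; rewrite eq_complex /=.
by rewrite !mulr0 subr0 add0r !eqxx.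
Qed.

Lemma walsh_carleson_ge0 f x : (0 <= walsh_carleson f x)%E.
Proof.
apply: le_trans (ereal_sup_ubound _); last by exists 0%N.
by rewrite lee_fin normc_ge0.
Qed.

Lemma measure_torus : mu torus = 1%E.
Proof. by rewrite /Defs.torus lebesgue_measure_itv /= lte_fin ltr01 oppr0 adde0. Qed.

(** * Integrability of functions in [L^p] of the torus *)

Section Integrability.
Variables (p : R) (f : R -> R[i]).
Hypotheses (p1 : 1 < p) (fp : in_Lp p f).

Let p_ge0 : 0 <= p.
Proof. by rewrite ltW// (lt_trans _ p1). Qed.

Let N x : R := Normc.normc (f x).

Let N_ge0 x : 0 <= N x.
Proof. exact: normc_ge0. Qed.

Let Np_E x : N x `^ p = (complex.Re (f x) ^+ 2 + complex.Im (f x) ^+ 2) `^ (p / 2).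
Proof.
rewrite /N; case: (f x) => a b /=.
by rewrite -powR12_sqrt ?addr_ge0 ?sqr_ge0// -powRrM mulrC.
Qed.

Let measurable_Np : measurable_fun torus (fun x => N x `^ p).
Proof.
have [mRe mIm _] := fp.
rewrite (_ : (fun x => _) = (@powR R ^~ (p / 2)) \o
    (fun x => complex.Re (f x) ^+ 2 + complex.Im (f x) ^+ 2)).
  apply: measurableT_comp; first exact: measurable_powR.
  by apply: measurable_funD; apply: measurable_funX.
by apply/funext => x; exact: Np_E.
Qed.

Let J := (\int[mu]_(x in torus) (N x `^ p)%:E)%E.

Let Lp_norm_J : Lp_norm p f = (J `^ p^-1)%E.
Proof.
rewrite /Lp_norm unlock; congr (_ `^ _)%E.
rewrite /J [RHS]integral_mkcond; apply: eq_integral => x _.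
rewrite !patchE; case: ifP => _; first by rewrite /= ger0_norm// N_ge0.
by rewrite abse0 poweR0r// gt_eqF// (lt_trans _ p1).
Qed.

Let J_ge0 : (0 <= J)%E.
Proof. by apply: integral_ge0 => x _; rewrite lee_fin powR_ge0. Qed.

Lemma integrable_normc_powR :
  mu.-integrable torus (fun x => (Normc.normc (f x) `^ p)%:E).
Proof.
apply/integrableP; split; first exact/measurable_EFinP.
rewrite (_ : integral _ _ _ = J); last first.
  by apply: eq_integral => x _; rewrite /= ger0_norm// powR_ge0.
rewrite ltey; apply/negP => /eqP JE.
have [_ _] := fp; rewrite Lp_norm_J JE poweRyr ?ltxx//.
by rewrite invr_neq0// gt_eqF// (lt_trans _ p1).
Qed.

Lemma Lp_normE :
  Lp_norm p f = ((\int[mu]_(x in torus) (Normc.normc (f x) `^ p)) `^ p^-1)%:E.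
Proof.
rewrite Lp_norm_J -poweR_EFin; congr (_ `^ _)%E.
rewrite /Rintegral fineK//; apply: integrable_fin_num; first exact: measurable_torus.
exact: integrable_normc_powR.
Qed.

Lemma integrable_component_powR (g : R -> R) : measurable_fun torus g ->
  (forall x, `|g x| <= Normc.normc (f x)) ->
  mu.-integrable torus (fun x => (`|g x| `^ p)%:E).
Proof.
move=> mg gN; apply: (le_integrable _ _ _ integrable_normc_powR).
- exact: measurable_torus.
- apply/measurable_EFinP; rewrite (_ : (fun x => _) = (@powR R ^~ p) \o (fun x => `|g x|))//.
  apply: measurableT_comp; first exact: measurable_powR.
  exact: measurableT_comp.
move=> x _ /=; rewrite lee_fin (ger0_norm (powR_ge0 _ _)) (ger0_norm (powR_ge0 _ _)).
by apply: ge0_ler_powR; rewrite ?nnegrE ?normc_ge0 ?gN.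
Qed.

(** On a space of finite measure, [|g|] is dominated by 1 plus its power of exponent [p]. *)
Lemma integrable_component (g : R -> R) : measurable_fun torus g ->
  (forall x, `|g x| <= Normc.normc (f x)) -> mu.-integrable torus (EFin \o g).
Proof.
move=> mg gN; have gp := integrable_component_powR mg gN.
have i1 : mu.-integrable torus (EFin \o (fun=> (1 : R))).
  apply: measurable_bounded_integrable => //; first exact: measurable_torus.
    by apply: (@le_lt_trans _ _ 1%E); rewrite ?ltry// -measure_torus.
  by exists 1; split => // s s1 x _; rewrite normr1 ltW.
have := @integrableD _ _ _ mu _ (@measurable_torus R) _ _ i1 gp.
apply: le_integrable; [exact: measurable_torus|exact/measurable_EFinP|].
move=> x _ /=; rewrite lee_fin [leRHS]ger0_norm ?addr_ge0 ?powR_ge0//.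
have [g1|g1] := leP `|g x| 1.
  by rewrite (le_trans g1)// lerDl powR_ge0.
apply: (@le_trans _ _ (`|g x| `^ p)); last by rewrite lerDr.
by rewrite -{1}[`|g x|]powRr1// ler_powR// ltW.
Qed.

Lemma Rintegral_component_powR (g : R -> R) : measurable_fun torus g ->
  (forall x, `|g x| <= Normc.normc (f x)) ->
  \int[mu]_(x in torus) (`|g x| `^ p) <=
  \int[mu]_(x in torus) (Normc.normc (f x) `^ p).
Proof.
move=> mg gN; apply: le_Rintegral.
- exact: measurable_torus.
- exact: integrable_component_powR.
- exact: integrable_normc_powR.
by move=> x _; apply: ge0_ler_powR; rewrite ?nnegrE ?normc_ge0 ?gN.
Qed.

End Integrability.
End Torus.

(** * Transfer from the finite model *)

Section WeakType.
Variables (R : realType) (p : R) (f : R -> R[i]) (lam : R).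
Hypotheses (p1 : 1 < p) (p2 : p <= 2) (fp : in_Lp p f) (lam0 : 0 < lam).
Notation mu := (@lebesgue_measure R).
Notation torus := (@torus R).

Let fRe x := complex.Re (f x).
Let fIm x := complex.Im (f x).
Let I := \int[mu]_(x in torus) (Normc.normc (f x) `^ p).
Let B := 4 * (1200 / (p - 1) / (lam / 2)) `^ p * I.

Let exceeds (M : nat) (b : {ffun 'I_M -> bool}) := [exists n : 'I_(2 ^ M),
  lam < Normc.normc (Complex (carleson (@cell_avg R M fRe) (nat_digits M n) b)
                             (carleson (@cell_avg R M fIm) (nat_digits M n) b))].

(** If the modulus exceeds [lam], the real or the imaginary part exceeds [lam / 2]. Two parts, each
    with the factor 2 of [card_carleson_scaled], give the 4 in [B]. *)
Let card_exceeds (M : nat) : #|@exceeds M|%:R / 2 ^+ M <= B.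
Proof.
have [mRe mIm _] := fp.
have lam2 : 0 < lam / 2 by rewrite divr_gt0.
pose S (g : R -> R) := [set b | [exists n, lam / 2 < `|carleson (@cell_avg R M g) n b|]]%SET.
have cS : (#|@exceeds M| <= #|S fRe| + #|S fIm|)%N.
  apply: leq_trans (leq_card_setU (S fRe) (S fIm)).
  apply: subset_leq_card; apply/fintype.subsetP => b /existsP[n].
  move/lt_le_trans => /(_ _ (normc_le _ _)) h.
  rewrite !inE; have [h1|h1] := ltP (lam / 2) `|carleson (@cell_avg R M fRe) (nat_digits M n) b|.
    by apply/orP; left; apply/existsP; exists (nat_digits M n).
  apply/orP; right; apply/existsP; exists (nat_digits M n).
  by move: h h1; move: (`|_|) (`|_|) => u v; lra.
have V0 : 0 < (2 ^+ M)^-1 :> R by rewrite invr_gt0 exprn_gt0.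
have bound (g : R -> R) : measurable_fun torus g ->
    (forall x, `|g x| <= Normc.normc (f x)) ->
    (2 ^+ M)^-1 * #|S g|%:R <= 2 * (1200 / (p - 1) / (lam / 2)) `^ p * I.
  move=> mg gN.
  have h1 := card_carleson_scaled (@cell_avg R M g) p1 p2 lam2.
  apply: le_trans (ler_wpM2l (ltW V0) h1) _; rewrite mulrCA.
  rewrite ler_wpM2l ?mulr_ge0 ?powR_ge0//.
  apply: le_trans (Rintegral_component_powR p1 fp mg gN).
  exact: (sum_cell_avg_powR M (integrable_component p1 fp mg gN) p1
    (integrable_component_powR p1 fp mg gN)).
have H : #|@exceeds M|%:R <= #|S fRe|%:R + #|S fIm|%:R :> R by rewrite -natrD ler_nat.
rewrite [_ / _]mulrC; apply: le_trans (ler_wpM2l (ltW V0) H) _; rewrite mulrDr.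
have -> : B = 2 * (1200 / (p - 1) / (lam / 2)) `^ p * I +
              2 * (1200 / (p - 1) / (lam / 2)) `^ p * I.
  by rewrite /B -!mulrDl; congr (_ * _ * _); ring.
apply: lerD.
- exact: bound fRe mRe (fun x => normc_ge_Re (f x)).
- exact: bound fIm mIm (fun x => normc_ge_Im (f x)).
Qed.

Let level (M : nat) := [set x | torus x /\ @exceeds M (digits M x)].

Let levelE M x : level M x <->
  torus x /\ exists2 n, (n < 2 ^ M)%N & lam < Normc.normc (walsh_partial_sum n f x).
Proof.
have [mRe mIm _] := fp.
have iRe := integrable_component p1 fp mRe (fun x => normc_ge_Re (f x)).
have iIm := integrable_component p1 fp mIm (fun x => normc_ge_Im (f x)).
split => -[tx].
  move=> /existsP[n h]; split => //; exists n => //.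
  by rewrite walsh_partial_sumE !(@partial_sum_cell_avg R M).
move=> [n nM h]; split => //; apply/existsP; exists (Ordinal nM).
by move: h; rewrite walsh_partial_sumE !(@partial_sum_cell_avg R M).
Qed.

(** The superlevel set is the increasing union of the sets [level M], all of measure at most [B];
    continuity of the measure from below concludes. *)
Lemma measure_walsh_carleson :
  (mu [set x | torus x /\ (lam%:E < `|walsh_carleson f x|)%E] <=
   (4 * (1200 / (p - 1) / (lam / 2)) `^ p *
    \int[mu]_(x in torus) (Normc.normc (f x) `^ p))%:E)%E.
Proof.
rewrite -/I -/B.
have -> : [set x | torus x /\ (lam%:E < `|walsh_carleson f x|)%E] = \bigcup_M level M.
  apply/seteqP; split => x.
    move=> [tx]; rewrite gee0_abs ?walsh_carleson_ge0// => /ereal_sup_gt[_ [n _ <-] h].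
    exists n; first by [].
    by apply/levelE; split; last by exists n; first exact: ltn_expl.
  move=> [M _ /levelE[tx [n _ h]]]; split; first exact: tx.
  rewrite gee0_abs ?walsh_carleson_ge0//.
  apply: (@lt_le_trans _ _ (Normc.normc (walsh_partial_sum n f x))%:E).
    by rewrite lte_fin.
  by apply: ereal_sup_ubound; exists n.
have mlevel M : measurable (level M) by exact: measurable_digits.
have nd : nondecreasing_seq level.
  move=> M M' MM'; apply/subsetPset => x /levelE[tx [n nM h]].
  apply/levelE; split; first exact: tx.
  by exists n; first by rewrite (leq_trans nM)// leq_exp2l.
have cv : mu \o level @ \oo --> mu (\bigcup_M level M).
  apply: nondecreasing_cvg_mu => //; apply: bigcup_measurable => M _.
  exact: mlevel.
rewrite -(cvg_lim _ cv)//; apply: lime_le; first by apply/cvg_ex; eexists; exact: cv.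
apply: nearW => M; rewrite [X in (X <= _)%E](@measure_digits R M (@exceeds M)).
by rewrite lee_fin; exact: card_exceeds.
Qed.

End WeakType.

Theorem theorem1p1 (R : realType) :
  exists c : R, 0 < c /\
    forall p : R, 1 < p -> p <= 2 ->
    forall f : R -> R[i], in_Lp p f ->
      (weak_Lp_norm p (walsh_carleson f) <= (c / (p - 1))%:E * Lp_norm p f)%E.
Proof.
(* The factor 8 is [4 * 2]: 4 bounds its own root of order [p], and 2 comes from the level
   [lam / 2]. *)
exists (8 * 1200); split=> [|p p1 p2 f fp]; first by apply: mulr_gt0; rewrite ltr0n.
apply: ge_ereal_sup => _ [lam /= lam0 <-].
rewrite (Lp_normE p1 fp) -EFinM.
have := measure_walsh_carleson p1 p2 fp lam0.
set I := \int[_]_(x in _) _; set m := lebesgue_measure _.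
have : 0 < 1200 :> R by rewrite ltr0n.
move: (1200 : R) => k k0 mB.
have p0 : 0 < p by lra.
have I0 : 0 <= I by apply: Rintegral_ge0 => x _; exact: powR_ge0.
set K := k / (p - 1) / (lam / 2) in mB.
have p10 : 0 < p - 1 by lra.
have K0 : 0 <= K by rewrite !divr_ge0 ?(ltW k0) ?(ltW p10) ?(ltW lam0).
have m0 : (0 <= m)%E by exact: measure_ge0.
have -> : 8 * k / (p - 1) * I `^ p^-1 = lam * (4 * K * I `^ p^-1).
  by rewrite /K; field; rewrite !gt_eqF.
rewrite EFinM lee_pmul2l ?lte_fin//.
have B0 : 0 <= 4 * K `^ p * I by rewrite !mulr_ge0 ?powR_ge0.
have : (m `^ p^-1 <= (4 * K `^ p * I)%:E `^ p^-1)%E.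
  apply: gt0_ler_poweR => //; first by rewrite invr_ge0 ltW.
    by rewrite in_itv /= m0 leey.
  by rewrite in_itv /= lee_fin B0 leey.
move/le_trans; apply; rewrite poweR_EFin lee_fin.
rewrite powRM ?mulr_ge0 ?powR_ge0// powRM ?powR_ge0// -powRrM mulfV ?gt_eqF// powRr1//.
rewrite ler_wpM2r ?powR_ge0// ler_wpM2r//.
by rewrite -[leRHS]powRr1// ler_powR// ?invf_le1// ?ltW//; lra.
Qed.
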